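(* Let $\Gamma$ be a graph, $\Phi$ an interaction on $\Gamma$ and $H_\Lambda=\sum_{X\subset\Lambda}\Phi(X)$ the associated Hamiltonians, satisfying the graph, interaction and frustration-freeness assumptions (G), (I), (FF) listed in the context. Suppose that $$\mathrm{gap}(\Gamma)=0 .$$ Then, for every $\epsilon>0$, $$\mathrm{gap}(\mathcal F_k)=o\left(\frac{k^{4+\epsilon}}{l_k^2}\right)\qquad\text{as } k\to\infty .$$
   Context: Graph assumption (G): $\Gamma$ is a graph with graph distance $d_\Gamma$, and there exist an integer $D\ge 1$, a constant $C_\Gamma\ge 1$ and an injective map $\iota:\Gamma\to\mathbb R^D$ such that $C_\Gamma^{-1}|\iota(i)-\iota(j)|\le d_\Gamma(i,j)\le C_\Gamma|\iota(i)-\iota(j)|$ for all $i,j\in\Gamma$ (Euclidean norm). $\Gamma$ is identified with $\iota(\Gamma)\subset\mathbb R^D$. Spin system: a positive integer $d$ (local dimension) is fixed. For finite $X\subset\Gamma$, $\mathcal H_X=\bigotimes_{i\in X}\mathbb C^d$, and $\mathcal A_X$ is the algebra of linear operators on $\mathcal H_X$; for $X\subset Y$, $\mathcal A_X\subset\mathcal A_Y$ via $A\mapsto A\otimes \mathrm{Id}_{Y\setminus X}$. An interaction assigns to each finite $X\subset\Gamma$ a Hermitian operator $\Phi(X)\in\mathcal A_X$. Interaction assumption (I): (i) there is $R>0$ with $\Phi(X)=0$ whenever $\mathrm{diam}(X)>R$ (diameter in $d_\Gamma$); (ii) $\Phi(X)\ge 0$ for all $X$, $\Phi_{\max}:=\sup_X\|\Phi(X)\|<\infty$,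 and $\Phi_{\min}:=\inf_{X:\Phi(X)\ne0}\min(\mathrm{spec}\,\Phi(X)\setminus\{0\})>0$. Hamiltonian: for finite $\Lambda\subset\Gamma$, $H_\Lambda=\sum_{X\subset\Lambda}\Phi(X)$ on $\mathcal H_\Lambda$. Frustration-freeness (FF): $\ker H_\Lambda\ne\{0\}$ for every finite $\Lambda\subset\Gamma$. The spectral gap is $\mathrm{gap}(H_\Lambda)=\inf(\mathrm{spec}\,H_\Lambda\setminus\{0\})$ (with $\inf\emptyset=+\infty$). Domains: $l_k=(3/2)^{k/D}$ and $R(k)=[0,l_{k+1}]\times\cdots\times[0,l_{k+D}]\subset\mathbb R^D$. $\mathcal F_k$ is the collection of all subsets of $\Gamma$ (identified with subsets of $\mathbb R^D$) which are contained in $R(k)$ up to translations and permutations of the Euclidean coordinates. Finally $\mathrm{gap}(\mathcal F_k)=\inf_{\Lambda\in\mathcal F_k}\mathrm{gap}(H_\Lambda)$ and $\mathrm{gap}(\Gamma)=\inf_{k\ge1}\mathrm{gap}(\mathcal F_k)$. *)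

(* Defs.v *)
From HB Require Import structures.
From mathcomp Require Import all_boot all_order all_algebra.
From mathcomp Require Import perm finmap.
From mathcomp Require Export complex.
From mathcomp Require Import all_classical all_reals all_analysis.

Set Implicit Arguments.
Unset Strict Implicit.
Unset Printing Implicit Defensive.

Import Order.TTheory GRing.Theory Num.Theory.
Import numFieldNormedType.Exports.

Local Open Scope classical_set_scope.
Local Open Scope ring_scope.
Local Open Scope ereal_scope.
Local Open Scope complex_scope.
Local Open Scope sesquilinear_scope.

(* The library norm on row vectors is the sup norm, hence this definition. *)
Definition eucl_norm (R : realType) (D : nat) (x : 'rV[R]_D) : R :=
  Num.sqrt (\sum_(c < D) x ord0 c ^+ 2)%R.

Section Graph.
Variables (R : realType) (V : choiceType) (adj : rel V).

(* [path adj i p] says that i :: p is a walk, of length [size p];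
   the distance is +oo between different components. *)
Definition graph_dist (i j : V) : \bar R :=
  ereal_inf [set (size p)%:R%:E | p in [set p : seq V | path adj i p /\ last i p = j]].

Definition diam (X : {fset V}) : \bar R :=
  ereal_sup [set graph_dist ij.1 ij.2 | ij in [set ij : V * V | ij.1 \in X /\ ij.2 \in X]].

Definition graph_assumption (D : nat) (iota : V -> 'rV[R]_D) : Prop :=
  [/\ (1 <= D)%N, injective iota &
      exists2 C : R, (1 <= C)%R &
        forall i j : V,
          (C^-1 * eucl_norm (iota i - iota j))%:E <= graph_dist i j /\
          graph_dist i j <= (C * eucl_norm (iota i - iota j))%:E].

End Graph.

Section Spectrum.
Variables (R : realType) (n : nat).
Implicit Types (A : 'M[R[i]]_n) (v : 'cV[R[i]]_n).

(* [eigenvalue] refers to row eigenvectors; the spectrum of a square matrix is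
   the same for its action on columns. *)
Definition spec A : set R[i] := [set z | eigenvalue A z].

(* Meant for Hermitian A, whose eigenvalues are real; +oo if spec A is {0}. *)
Definition gap A : \bar R :=
  ereal_inf [set (complex.Re z)%:E | z in spec A `\ 0%R].

Definition ker_nontrivial A : Prop := exists2 v : 'cV[R[i]]_n, v != 0%R & A *m v = 0%R.

Definition psd A : Prop :=
  A \is hermsymmx /\ forall v : 'cV[R[i]]_n, (0 <= (v ^t* *m A *m v) ord0 ord0)%R.

Definition l2norm v : R := Num.sqrt (\sum_k complex.Re `|v k ord0| ^+ 2)%R.

Definition opnorm A : \bar R :=
  ereal_sup [set (l2norm (A *m v))%:E | v in [set v : 'cV[R[i]]_n | (l2norm v <= 1)%R]].

End Spectrum.

Section SpinSystem.
Variables (R : realType) (V : choiceType) (d : nat).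

(* The configurations X -> {0..d-1} label the product basis of the tensor power
   of C^d over X. *)
Definition config (X : {fset V}) : finType := {ffun X -> 'I_d}.

(* The algebra A_X: matrices in the product basis, a configuration being
   turned into a matrix index by [enum_rank]. *)
Definition op (X : {fset V}) := 'M[R[i]]_#|config X|.

Definition restrict (X Y : {fset V}) (XY : (X `<=` Y)%fset) (s : config Y) :
  config X := [ffun x => s (fincl XY x)].

(* A |-> A (x) Id_(Y \ X). *)
Definition extend (X Y : {fset V}) (XY : (X `<=` Y)%fset) (A : op X) : op Y :=
  \matrix_(a, b)
    let s : config Y := enum_val a in
    let t : config Y := enum_val b in
    if [forall y : Y, (val y \notin X) ==> (s y == t y)]
    then A (enum_rank (restrict XY s)) (enum_rank (restrict XY t)) else 0%R.

Definition interaction := forall X : {fset V}, op X.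

Implicit Types Phi : interaction.

Lemma fpowerset_sub (L : {fset V}) (X : fpowerset L) : (val X `<=` L)%fset.
Proof. by rewrite -fpowersetE; exact: valP. Qed.

Definition hamiltonian Phi (L : {fset V}) : op L :=
  (\sum_(X : fpowerset L) extend (fpowerset_sub X) (Phi (val X)))%R.

Definition Phi_max Phi : \bar R := ereal_sup [set opnorm (Phi X) | X in [set: {fset V}]].

Definition Phi_min Phi : \bar R :=
  ereal_inf [set gap (Phi X) | X in [set X : {fset V} | Phi X != 0%R]].

Definition interaction_assumption (adj : rel V) Phi : Prop :=
  [/\ exists2 r : R, (0 < r)%R & forall X, r%:E < diam R adj X -> Phi X = 0%R,
      forall X, psd (Phi X),
      Phi_max Phi < +oo &
      0 < Phi_min Phi].

Definition frustration_free Phi : Prop :=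
  forall L : {fset V}, ker_nontrivial (hamiltonian Phi L).

End SpinSystem.

Section Domains.
Variables (R : realType) (V : choiceType) (D : nat) (iota : V -> 'rV[R]_D).

Definition l_ (k : nat) : R := ((3 / 2) `^ (k%:R / D%:R))%R.

(* The c-th side, c = 0, ..., D-1, has length l_(k+c+1). *)
Definition box (k : nat) : set 'rV[R]_D :=
  [set x : 'rV[R]_D | forall c : 'I_D, (0 <= x ord0 c <= l_ (k + c.+1))%R].

(* Rigidly moved by the coordinate permutation s and the translation t, a
   member of the family is contained in [box k]. *)
Definition F_ (k : nat) : set (set V) :=
  [set L | exists (s : 'S_D) (t : 'rV[R]_D),
     forall i, L i -> box k (col_perm s (iota i) + t)%R].

Variables (d : nat) (Phi : interaction R V d).

(* Under [graph_assumption] the points iota i are uniformly separated, so all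
   the members of F_ k are finite. *)
Definition gapF (k : nat) : \bar R :=
  ereal_inf [set gap (hamiltonian Phi L) | L in [set L : {fset V} | F_ k [set` L]]].

Definition gapGamma : \bar R := ereal_inf [set gapF k | k in [set k | (1 <= k)%N]].

End Domains.

(* Main.v *)
(** A spatial cut of a region [L = A u B] with an overlap of width [w] costs
    little gap. Put the terms in slabs orthogonal to the cut, and let [D] be the
    product of the contractions [1 - Phi(X) / M], first over the odd slabs and
    then over the even ones. By the detectability lemma, [|D u|^2 <= a |u|^2] on
    the excited space, with [a = eta / (x + eta)] and [x] the gap on [L]. By
    finite propagation speed, if [phi] is a ground state of [A] and [psi] one
    of [B], then [<phi, (D* D)^j psi> = <phi, psi>] for all [j <= m ~ w].
    Inserting the Chebyshev polynomial of degree [m], rescaled to [[0, a]], one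
    gets [<phi, psi> <= |phi| |psi| / (1 + 2 m^2 x / eta)] for excited [phi] and
    [psi], and hence
      [P_A^perp + P_B^perp >= (1 - 1 / (1 + 2 m^2 x / eta)) P_L^perp].
    Averaging over [s] cuts with disjoint overlaps of width [~ l_k / s] and
    solving for [x], one finds, for every lower bound [mu] on [gap (F_k)],
      [gap (F_(k+1)) >= s / (s + 1) mu - C s^2 / l_k^2].
    Take [s + 1 = (k + 1)^2]: the factors have a positive infinite product, and
    the errors [k^4 / l_k^2] decay geometrically. So if [gap (F_k)] exceeds
    [c k^(4+e) / l_k^2] at one large [k], it stays bounded away from [0]. *)

Require Import Defs.
From HB Require Import structures.
From mathcomp Require Import all_boot all_order all_algebra.
From mathcomp Require Import fingroup perm finmap complex.
From mathcomp Require Import all_classical all_reals all_analysis.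
From mathcomp Require Import ring lra zify.

Set Implicit Arguments.
Unset Strict Implicit.
Unset Printing Implicit Defensive.

Import Order.TTheory GRing.Theory Num.Theory.
Import numFieldNormedType.Exports.

Local Open Scope classical_set_scope.
Local Open Scope ring_scope.

Local Open Scope complex_scope.
Local Open Scope sesquilinear_scope.

(** * Real inner product spaces *)

Record inner (R : rcfType) (W : lmodType R) := Inner {
  ip :> W -> W -> R;
  ipC : forall u v, ip u v = ip v u;
  ipDr : forall u v w, ip u (v + w) = ip u v + ip u w;
  ipZr : forall a u v, ip u (a *: v) = a * ip u v;
  ip_ge0 : forall u, 0 <= ip u u }.

Section InnerTheory.
Variables (R : rcfType) (W : lmodType R) (ip : inner W).
Implicit Types (u v w : W) (a : R).

Definition ipnorm u := Num.sqrt (ip u u).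

Lemma ipDl u v w : ip (u + v) w = ip u w + ip v w.
Proof. by rewrite ipC ipDr !(ipC ip w). Qed.

Lemma ipZl a u v : ip (a *: u) v = a * ip u v.
Proof. by rewrite ipC ipZr ipC. Qed.

Lemma ip0r u : ip u 0 = 0.
Proof. by rewrite -(scale0r 0) ipZr mul0r. Qed.

Lemma ipNr u v : ip u (- v) = - ip u v.
Proof. by rewrite -scaleN1r ipZr mulN1r. Qed.

Lemma ipNl u v : ip (- u) v = - ip u v.
Proof. by rewrite ipC ipNr ipC. Qed.

Lemma ipBr u v w : ip u (v - w) = ip u v - ip u w.
Proof. by rewrite ipDr ipNr. Qed.

Lemma ipBl u v w : ip (u - v) w = ip u w - ip v w.
Proof. by rewrite ipDl ipNl. Qed.

Lemma ipD_sq u v : ip (u + v) (u + v) = ip u u + 2 * ip u v + ip v v.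
Proof. by rewrite !ipDl !ipDr (ipC ip v u); ring. Qed.

Lemma ipB_sq u v : ip (u - v) (u - v) = ip u u - 2 * ip u v + ip v v.
Proof. by rewrite !ipBl !ipBr (ipC ip v u); ring. Qed.

Lemma ipnorm_ge0 u : 0 <= ipnorm u.
Proof. exact: sqrtr_ge0. Qed.

Lemma ipnorm_sqr u : ipnorm u ^+ 2 = ip u u.
Proof. by rewrite sqr_sqrtr ?ip_ge0. Qed.

Lemma ipnorm_le u v : (ipnorm u <= ipnorm v) = (ip u u <= ip v v).
Proof. by rewrite /ipnorm ler_psqrt ?nnegrE ?ip_ge0. Qed.

Lemma ipnormN u : ipnorm (- u) = ipnorm u.
Proof. by rewrite /ipnorm ipNl ipNr opprK. Qed.

Lemma cauchy_schwarz u v : ip u v ^+ 2 <= ip u u * ip v v.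
Proof.
have h a b : 0 <= a ^+ 2 * ip u u - 2 * (a * b * ip u v) + b ^+ 2 * ip v v.
  have := ip_ge0 ip (a *: u - b *: v); rewrite ipB_sq !ipZl !ipZr.
  by congr (0 <= _); ring.
have [v0|v0] := eqVneq (ip v v) 0.
  have [->|y0] := eqVneq (ip u v) 0; first by rewrite v0 expr0n mulr0.
  (* The form may be degenerate. If [ip v v] vanishes but [ip u v] does not, this coefficient makes
     the square in [h] equal to [- ip u u - 2]. *)
  have := h 1 ((ip u u + 1) / ip u v); have := ip_ge0 ip u.
  by rewrite v0 mul1r mulfVK//; lra.
have vp : 0 < ip v v by rewrite lt_neqAle eq_sym v0 ip_ge0.
by have := h (ip v v) (ip u v) => {}h; rewrite -(ler_pM2l vp); nra.
Qed.

Lemma ip_le_norm u v : ip u v <= ipnorm u * ipnorm v.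
Proof.
rewrite /ipnorm -sqrtrM ?ip_ge0// (le_trans (ler_norm _))// -sqrtr_sqr.
by rewrite ler_wsqrtr// cauchy_schwarz.
Qed.

Lemma ipnormD u v : ipnorm (u + v) <= ipnorm u + ipnorm v.
Proof.
rewrite -(@ler_pXn2r _ 2)// ?nnegrE ?addr_ge0 ?ipnorm_ge0//.
rewrite sqrrD !ipnorm_sqr ipD_sq.
have := ip_le_norm u v; lra.
Qed.

End InnerTheory.

(** * The detectability lemma *)

Section Detectability.
Variables (R : rcfType) (W : lmodType R) (ip : inner W) (I : eqType).
Variable b : I -> {linear W -> W}.
Hypothesis b_sym : forall i u v, ip u (b i v) = ip (b i u) v.
Hypothesis b_contr : forall i v, ip (b i v) (b i v) <= ip v v.
Implicit Types (l : seq I) (v : W).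

(** In the application [b i] is the square root of [Phi(X) / M], so this is the contraction
    [1 - Phi(X) / M]. *)
Definition damp i v : W := v - b i (b i v).

Definition damps l v : W := foldr damp v l.

Lemma damp_sym i u v : ip u (damp i v) = ip (damp i u) v.
Proof. by rewrite ipBr ipBl !b_sym. Qed.

Lemma damps_rev l u v : ip u (damps l v) = ip (damps (rev l) u) v.
Proof.
elim: l u v => [//|i l IH] u v.
by rewrite /= damp_sym IH rev_cons -cats1 /damps foldr_cat.
Qed.

(** The square expands to [|v|^2 - 2 |b v|^2 + |b^2 v|^2], and the last term is at most
    [|b v|^2]. *)
Lemma damp_decrease i v :
  ip (damp i v) (damp i v) <= ip v v - ip (b i v) (b i v).
Proof. by rewrite ipB_sq b_sym; have := b_contr i (b i v); lra. Qed.

Lemma damp_contr i v : ip (damp i v) (damp i v) <= ip v v.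
Proof. by rewrite (le_trans (damp_decrease i v))// gerBl ip_ge0. Qed.

Variable nb : rel I.
Hypothesis nb_refl : reflexive nb.
Hypothesis nb_sym : symmetric nb.
Hypothesis nb_comm : forall i j v, ~~ nb i j -> b i (b j v) = b j (b i v).

Lemma damp_comm i j v : ~~ nb i j -> damp i (damp j v) = damp j (damp i v).
Proof.
move=> h; have h' : ~~ nb j i by rewrite nb_sym.
rewrite /damp !linearB /= !(nb_comm _ h) !opprK -!addrA; congr (_ + _).
by rewrite addrCA.
Qed.

Lemma energy_comm i j v : ~~ nb i j ->
  ipnorm ip (b i (damp j v)) <= ipnorm ip (b i v).
Proof.
move=> hc; suff -> : b i (damp j v) = damp j (b i v).
  by rewrite ipnorm_le damp_contr.
by rewrite /damp linearB /= !(nb_comm _ hc).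
Qed.

Lemma energy_damp i j v :
  ipnorm ip (b i (damp j v)) <= ipnorm ip (b i v) + ipnorm ip (b j v).
Proof.
rewrite /damp linearB /= (le_trans (ipnormD _ _ _))// lerD2l ipnormN.
by rewrite ipnorm_le (le_trans (b_contr _ _)).
Qed.

Lemma energy_self i v : ipnorm ip (b i (damp i v)) <= ipnorm ip (b i v).
Proof.
by rewrite (_ : b i _ = damp i (b i v)) ?ipnorm_le ?damp_contr// /damp linearB.
Qed.

(* [c i] is the norm of [b i phi] for the partial product [phi] of [v] on which
   the factor [damp i] acts. *)
Lemma damps_energy l v : uniq l -> exists2 c : I -> R,
  forall i, i \in l -> ipnorm ip (b i (damps l v)) <= \sum_(j <- l | nb i j) c j &
  (forall i, 0 <= c i) /\
  \sum_(j <- l) c j ^+ 2 <= ip v v - ip (damps l v) (damps l v).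
Proof.
elim: l => [_|j l IH /= /andP[jl /IH[c hc [c0 hs]]]].
  by exists (fun=> 0) => //; split => //; rewrite big_nil /= subrr.
set w := damps l v in hc hs *.
pose c' i := if i == j then ipnorm ip (b j w) else c i.
have c'l (P : pred I) (F : R -> R) :
    \sum_(i <- l | P i) F (c' i) = \sum_(i <- l | P i) F (c i).
  rewrite big_seq_cond [RHS]big_seq_cond; apply: eq_bigr => i /andP[il _].
  by rewrite /c'; case: eqP => // ij; rewrite -ij il in jl.
have c'0 i : 0 <= c' i by rewrite /c'; case: ifP => // _; rewrite ipnorm_ge0.
exists c'; last first.
  split=> //; rewrite big_cons (c'l xpredT (fun x => x ^+ 2)) /c' eqxx.
  by rewrite ipnorm_sqr; have := damp_decrease j w; lra.
move=> i; rewrite inE big_cons (c'l _ id).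
have [->{i} _|ij /= il] := eqVneq i j.
  rewrite nb_refl (le_trans (energy_self _ _))//.
  by rewrite {1}/c' eqxx lerDl sumr_ge0.
(* If [b i] commutes with [b j], the new factor does not increase the energy of [i]; otherwise it
   adds at most [|b j w|], the summand recorded for [j]. *)
have [ij1|ij1] := boolP (nb i j); last first.
  by rewrite (le_trans _ (hc i il))// energy_comm.
rewrite (le_trans (energy_damp _ _ _))// addrC {1}/c' eqxx lerD2l.
exact: hc.
Qed.

Lemma sum_sqr_le (c : I -> R) l :
  (\sum_(i <- l) c i) ^+ 2 <= (size l)%:R * \sum_(i <- l) c i ^+ 2.
Proof.
elim: l => [|i l IH]; first by rewrite !big_nil mulr0 expr0n.
rewrite !big_cons /= -natr1.
set S := \sum_(j <- l) c j in IH *; set T := \sum_(j <- l) _ in IH *.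
have [l0|l0] := eqVneq (size l) 0.
  by rewrite /S /T (size0nil l0) !big_nil /= add0r mul1r !addr0.
have m0 : 0 < (size l)%:R :> R by rewrite ltr0n lt0n.
move: (size l)%:R m0 IH => m m0 IH.
have h : 0 <= (m * c i - S) ^+ 2 by exact: sqr_ge0.
have : m * (2 * c i * S) <= m * (m * c i ^+ 2 + T) by nra.
by rewrite ler_pM2l// => ?; nra.
Qed.

(** Energy left in the product is paid for by norm lost along the way. Each [|b i D v|] is a sum of
    at most [g] losses: Cauchy-Schwarz gives one factor [g], and the exchange of sums gives the
    other, since each loss is charged to at most [g] terms. *)
Lemma detectability l v (g : nat) : uniq l ->
  (forall i, i \in l -> (count (nb i) l <= g)%N) ->
  \sum_(i <- l) ip (b i (damps l v)) (b i (damps l v)) <=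
  g%:R ^+ 2 * (ip v v - ip (damps l v) (damps l v)).
Proof.
move=> ul hg; have [c hc [c0 hs]] := damps_energy v ul.
have h1 i : i \in l ->
    ip (b i (damps l v)) (b i (damps l v)) <=
    g%:R * \sum_(j <- l | nb i j) c j ^+ 2.
  move=> il; rewrite -ipnorm_sqr.
  apply: (@le_trans _ _ ((\sum_(j <- l | nb i j) c j) ^+ 2)).
    by rewrite ler_pXn2r ?nnegrE ?ipnorm_ge0 ?sumr_ge0// hc.
  rewrite -!(big_filter l) (le_trans (sum_sqr_le _ _))// ler_wpM2r//.
    by rewrite sumr_ge0// => j _; rewrite sqr_ge0.
  by rewrite size_filter ler_nat hg.
rewrite expr2 -mulrA.
apply: (@le_trans _ _ (\sum_(i <- l) g%:R * \sum_(j <- l | nb i j) c j ^+ 2)).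
  by rewrite big_seq [leRHS]big_seq; apply: ler_sum => i il; exact: h1.
rewrite -big_distrr /= ler_wpM2l ?ler0n//.
rewrite (exchange_big_dep xpredT)//= .
apply: (@le_trans _ _ (\sum_(j <- l) g%:R * c j ^+ 2)); last first.
  by rewrite -big_distrr /= ler_wpM2l.
rewrite big_seq [leRHS]big_seq; apply: ler_sum => j jl.
rewrite big_const_seq iter_addr_0 -[leLHS]mulr_natl ler_wpM2r ?sqr_ge0// ler_nat.
by rewrite (eq_count (a2 := nb j)) ?hg// => i; rewrite /= nb_sym.
Qed.

End Detectability.

(** * Chebyshev polynomials of an operator *)

Section Chebyshev.
Variables (R : rcfType) (W : lmodType R) (ip : inner W).

(** The pair [(T_k(z), U_(k-1)(z))] of Chebyshev polynomials of the first and second kind. *)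
Fixpoint cheb_scal (z : R) k : R * R :=
  if k is k'.+1 then
    let: (t, u) := cheb_scal z k' in (z * t + (z ^+ 2 - 1) * u, z * u + t)
  else (1, 0).

(** To the right of [1], [T_k] stays above its tangent at [1], whose slope is [k^2], and [U_(k-1)]
    stays above its value [k] there; the two bounds feed each other in the induction. *)
Lemma cheb_scal_ge y k : 0 <= y ->
  1 + k%:R ^+ 2 * y <= (cheb_scal (1 + y) k).1 /\ k%:R <= (cheb_scal (1 + y) k).2.
Proof.
move=> y0; elim: k => [|k]; first by rewrite expr0n mul0r addr0 lexx.
rewrite /= -natr1; case: (cheb_scal _ k) => t u /=.
have : 0 <= k%:R :> R by exact: ler0n.
move: k%:R => c c0 [ht hu].
have y1 : 0 <= (1 + y) ^+ 2 - 1 by nra.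
have := ler_wpM2l y1 hu.
have := ler_wpM2l (addr_ge0 ler01 y0) ht.
have := ler_wpM2l (addr_ge0 ler01 y0) hu.
by move=> *; split; nra.
Qed.

Variable S : {linear W -> W}.
Hypothesis S_sym : forall u v, ip u (S v) = ip (S u) v.
Variable P : W -> Prop.
Hypotheses (P0 : P 0) (PD : forall u v, P u -> P v -> P (u + v)).
Hypotheses (PZ : forall a u, P u -> P (a *: u)) (PS : forall u, P u -> P (S u)).
Variable a : R.
Hypothesis a_gt0 : 0 < a.
Hypothesis S_le : forall u, P u -> ip (S u) (S u) <= a * ip u (S u).

(** [S_le] says that [S^2 <= a S] on the subspace [P], i.e. that the spectrum of [S] there lies in
    [[0, a]]; this affine map carries that interval to [[-1, 1]]. *)
Let S' u := (2 / a) *: S u - u.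

(* [T_k] and [U_k] of the rescaled operator, applied to a vector; the pair
   recursion makes Pell's identity [T^2 + (1 - x^2) U^2 = 1] an invariant. *)
Fixpoint cheb_vec (psi : W) k : W * W :=
  if k is k'.+1 then
    let: (t, u) := cheb_vec psi k' in (S' t + (S' (S' u) - u), S' u + t)
  else (psi, 0).

Lemma P_S' u : P u -> P (S' u).
Proof.
by move=> Pu; apply: PD; [apply/PZ/PS | rewrite -scaleN1r; apply: PZ].
Qed.

Lemma cheb_vec_P psi k : P psi ->
  P (cheb_vec psi k).1 /\ P (cheb_vec psi k).2.
Proof.
move=> Ppsi; elim: k => [//|k /=]; case: (cheb_vec _ k) => t u /= [Pt Pu].
split; apply: PD => //; try exact: P_S'.
by apply: PD; [do 2!apply: P_S' | rewrite -scaleN1r; apply: PZ].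
Qed.

Lemma S'_sym u v : ip u (S' v) = ip (S' u) v.
Proof. by rewrite /S' ipBr ipBl ipZr ipZl S_sym. Qed.

Lemma cheb_vec_pell psi k :
  let: (t, u) := cheb_vec psi k in
  ip t t + (ip u u - ip (S' u) (S' u)) = ip psi psi.
Proof.
elim: k => [|k] /=.
  by rewrite /S' linear0 scaler0 subr0 !ip0r subrr addr0.
case: (cheb_vec _ k) => t u <-.
have S'D x y : S' (x + y) = S' x + S' y.
  by rewrite /S' linearD scalerDr opprD addrACA.
have -> : S' t + (S' (S' u) - u) = S' (S' u + t) - u.
  by rewrite (S'D (S' u) t) addrA (addrC (S' t)).
set w := S' u + t.
have h1 : ip w (S' u) = ip (S' u) (S' u) + ip (S' u) t.
  by rewrite /w ipDl (ipC ip t).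
have h2 : ip w w = _ := ipD_sq ip (S' u) t.
by rewrite ipB_sq -(S'_sym w u) h1 h2; lra.
Qed.

(** By Pell's identity [|psi|^2 - |t|^2 = |u|^2 - |S' u|^2], and this is
    [(2 / a)^2 (a <u, S u> - |S u|^2)]. So the contraction property follows without diagonalising
    [S]. *)
Lemma cheb_vec_contr psi k : P psi -> ipnorm ip (cheb_vec psi k).1 <= ipnorm ip psi.
Proof.
move=> Ppsi; have [_ Pu] := cheb_vec_P k Ppsi; have := cheb_vec_pell psi k.
case: (cheb_vec _ k) Pu => t u /= /S_le h e.
rewrite ipnorm_le -e lerDl /S' ipB_sq ipZl !ipZr ipZl (ipC ip (S u) u).
set x := ip (S u) (S u) in h *; set y := ip u (S u) in h *.
suff : 0 <= (2 / a) ^+ 2 * (a * y - x).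
  by rewrite mulrBr (_ : (2 / a) ^+ 2 * (a * y) = 2 * (2 / a * y));
    [lra | field; exact: lt0r_neq0].
by rewrite mulr_ge0 ?sqr_ge0// subr_ge0.
Qed.

Lemma iter0 j : iter j S 0 = 0.
Proof. by elim: j => [//|j /= ->]; rewrite linear0. Qed.

Lemma iterD j u v : iter j S (u + v) = iter j S u + iter j S v.
Proof. by elim: j => [//|j /= ->]; rewrite linearD. Qed.

Lemma iterN j u : iter j S (- u) = - iter j S u.
Proof. by elim: j => [//|j /= ->]; rewrite linearN. Qed.

Lemma iterZ j c u : iter j S (c *: u) = c *: iter j S u.
Proof. by elim: j => [//|j /= ->]; rewrite linearZ. Qed.

Lemma cheb_vec_ip phi psi m k :
  (forall j, (j <= m)%N -> ip phi (iter j S psi) = ip phi psi) ->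
  let: (t, u) := cheb_vec psi k in let: (t', u') := cheb_scal (2 / a - 1) k in
  (forall j, (j + k <= m)%N -> ip phi (iter j S t) = t' * ip phi psi) /\
  (forall j, (j + k <= m.+1)%N -> ip phi (iter j S u) = u' * ip phi psi).
Proof.
move=> h; elim: k => [|k] /=.
  split=> j; first by rewrite addn0 mul1r => /h.
  by rewrite iter0 ip0r mul0r.
case: (cheb_vec _ k) => t u; case: (cheb_scal _ k) => t' u' [ht hu].
have e j x : ip phi (iter j S (S' x)) =
    2 / a * ip phi (iter j.+1 S x) - ip phi (iter j S x).
  by rewrite iterD iterN iterZ ipBr ipZr -iterSr.
split=> j hj.
  rewrite (iterD j (S' t)) (iterD j (S' (S' u))) iterN !ipDr ipNr !e !ht ?hu//; try by lia.
  by ring.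
by rewrite (iterD j (S' u)) ipDr e ht ?hu//; try lia; ring.
Qed.

(** [T_m] multiplies the overlap by its value at [2 / a - 1 >= 1], which is large, while it does not
    increase the norm of [psi]. *)
Lemma chebyshev_bound phi psi m : a <= 1 -> P psi ->
  (forall j, (j <= m)%N -> ip phi (iter j S psi) = ip phi psi) ->
  ip phi psi * (1 + m%:R ^+ 2 * (2 / a - 2)) <= ipnorm ip phi * ipnorm ip psi.
Proof.
move=> a1 Ppsi h; have := cheb_vec_ip m h; have := cheb_vec_contr m Ppsi.
have y0 : 0 <= 2 / a - 2.
  by rewrite subr_ge0 ler_pdivlMr// ler_piMr.
have [+ _] := cheb_scal_ge m y0; rewrite (_ : 1 + (2 / a - 2) = 2 / a - 1); last by ring.
case: (cheb_vec _ m) => t u; case: (cheb_scal _ m) => t' u' /= ht' ht [/(_ 0)].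
rewrite add0n leqnn => /(_ isT) /= e _.
have [le0|gt0] := lerP (ip phi psi) 0.
  rewrite (@le_trans _ _ 0)//; last by rewrite mulr_ge0 ?ipnorm_ge0.
  by rewrite mulr_le0_ge0// addr_ge0// mulr_ge0// exprn_ge0// ler0n.
rewrite mulrC (le_trans (ler_wpM2r (ltW gt0) ht'))// -e.
by rewrite (le_trans (ip_le_norm _ _ _))// ler_wpM2l ?ipnorm_ge0.
Qed.

End Chebyshev.

(** [a] and [b] stand for the projections of [v] onto two subspaces. With
    [q = |a|^2 + |b|^2 = <v, a + b>], Cauchy-Schwarz and [|a + b|^2 <= (1 + delta) q] give the
    bound. *)
Lemma two_projections (R : rcfType) (W : lmodType R) (ip : inner W) (v a b : W)
    (delta : R) : 0 <= delta -> ip v a = ip a a -> ip v b = ip b b ->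
  ip a b <= delta * (ipnorm ip a * ipnorm ip b) ->
  ip a a + ip b b <= (1 + delta) * ip v v.
Proof.
move=> d0 ha hb hab.
set q := ip a a + ip b b.
have q0 : 0 <= q by rewrite addr_ge0 ?ip_ge0.
have h1 : ip (a + b) (a + b) <= (1 + delta) * q.
  rewrite ipD_sq /q -!ipnorm_sqr.
  move: (ipnorm ip a) (ipnorm ip b) hab => x y hab.
  by have := mulr_ge0 d0 (sqr_ge0 (x - y)); nra.
have h2 : q ^+ 2 <= ip v v * ((1 + delta) * q).
  rewrite {1}(_ : q = ip v (a + b)); last by rewrite ipDr ha hb.
  by rewrite (le_trans (cauchy_schwarz _ _ _))// ler_wpM2l ?ip_ge0.
have [->|qn0] := eqVneq q 0; first by rewrite mulr_ge0 ?ip_ge0 ?addr_ge0.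
have qp : 0 < q by rewrite lt_neqAle eq_sym qn0.
by rewrite -(ler_pM2r qp); move: h2; rewrite expr2; lra.
Qed.

(** * Finite propagation speed *)

Section LightCone.
Variables (R : rcfType) (W : lmodType R) (ip : inner W) (I : eqType).
Variable b : I -> {linear W -> W}.
Hypothesis b_sym : forall i u v, ip u (b i v) = ip (b i u) v.
Hypothesis b_contr : forall i v, ip (b i v) (b i v) <= ip v v.
Variables (l : seq I) (nb : rel I).
Hypothesis l_uniq : uniq l.
Hypothesis nb_refl : reflexive nb.
Hypothesis nb_sym : symmetric nb.
Hypothesis nb_comm : forall i j v, ~~ nb i j -> b i (b j v) = b j (b i v).
Variable pos : I -> nat.
Hypothesis nb_pos : {in l &, forall i j, nb i j -> (pos i <= (pos j).+1)%N}.
Variables (N : nat) (phi psi : W).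
Hypothesis psi_fixed : {in l, forall i, (1 <= pos i)%N -> b i psi = 0}.
Hypothesis phi_fixed : {in l, forall i, (pos i <= N)%N -> b i phi = 0}.

(* [x] is obtained from [psi] by an operator that commutes with the terms at
   positions [>= r] and whose adjoint fixes [phi]. *)
Definition reached r x := exists M : W -> W,
  [/\ x = M psi, forall w, ip phi (M w) = ip phi w &
      {in l, forall i, (r <= pos i)%N -> forall w, damp b i (M w) = M (damp b i w)}].

Lemma damp_fixed i v : b i v = 0 -> damp b i v = v.
Proof. by move=> h; rewrite /damp h linear0 subr0. Qed.

(** Factors of one layer have positions of equal parity, so distinct positions differ by at least
    [2]. This is why a whole layer widens the light cone by a single position. *)
Lemma reached_layer r x ls e : (1 <= r)%N -> (r <= N.+1)%N ->
  {subset ls <= l} -> {in ls, forall i, odd (pos i) = e} ->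
  reached r x -> reached r.+1 (damps b ls x).
Proof.
move=> r1 rN lsl hodd [M [-> Mphi Mcomm]].
pose lf := [seq i <- ls | (pos i < r)%N].
have lf_mem i : i \in lf -> i \in l /\ (pos i < r)%N.
  by rewrite mem_filter => /andP[? /lsl].
have comm (s : seq I) j w : j \in l -> {in s, forall i, ~~ nb j i} ->
    damp b j (damps b s w) = damps b s (damp b j w).
  move=> jl; elim: s => [//|i s IH] hs /=.
  rewrite (damp_comm nb_sym nb_comm) ?hs ?mem_head//.
  by rewrite IH// => k ks; rewrite hs// inE ks orbT.
have far i j : i \in l -> j \in l -> ((pos j).+1 < pos i)%N -> ~~ nb i j.
  by move=> il jl h; apply: contraTN h => /nb_pos; rewrite -leqNgt; apply.
(* A factor at a position [>= r] commutes with the kept factors, by parity, and with [M]; it thus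
   reaches [psi], which it fixes because [r >= 1]. *)
have -> : damps b ls (M psi) = damps b lf (M psi).
  rewrite /lf; elim: ls lsl hodd {lf lf_mem} => [//|i s IH] lsl hodd /=.
  have sl : {subset s <= l} by move=> j js; apply: lsl; rewrite inE js orbT.
  have hs : {in s, forall j, odd (pos j) = e}.
    by move=> j js; apply: hodd; rewrite inE js orbT.
  rewrite -/(damps b s _) IH//; case: ltnP => // ri.
  have il : i \in l by rewrite lsl ?mem_head.
  rewrite comm//; first by rewrite Mcomm// damp_fixed// psi_fixed// (leq_trans r1).
  move=> j; rewrite mem_filter => /andP[jr js]; apply: far => //; first exact: sl.
  rewrite ltn_neqAle (leq_trans jr ri) andbT.
  apply/eqP => e1; have := hodd i; rewrite mem_head -e1 /= (hs j js).
  by case: (e) => /(_ isT).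
exists (fun w => damps b lf (M w)); split=> //.
  (* The kept factors are moved onto [phi], which they fix: their positions are below [r], hence at
     most [N]. *)
  move=> w; rewrite (damps_rev b_sym).
  have -> : damps b (rev lf) phi = phi; last exact: Mphi.
  have : {in rev lf, forall i, damp b i phi = phi}.
    move=> i; rewrite mem_rev => /lf_mem[il ir]; rewrite damp_fixed// phi_fixed//.
    by rewrite -ltnS (leq_trans ir).
  elim: (rev lf) => [//|i s IH hs] /=.
  rewrite -/(damps b s _) IH ?hs ?mem_head// => j js.
  by rewrite hs// inE js orbT.
move=> i il ri w; rewrite comm// ?Mcomm//; first by rewrite ltnW.
by move=> j /lf_mem[jl jr]; apply: far => //; apply: leq_ltn_trans ri.
Qed.

Let lo := [seq i <- l | odd (pos i)].
Let le := [seq i <- l | ~~ odd (pos i)].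

(** This is [D* D], where [D] applies the odd layer and then the even one: the factors are
    symmetric, so reversing the list gives the adjoint. *)
Definition sweep v := damps b (rev (le ++ lo)) (damps b (le ++ lo) v).

(** A sweep consists of four layers, odd, even, even, odd, each costing one position. *)
Lemma reached_sweep r x : (1 <= r)%N -> (r + 3 <= N.+1)%N ->
  reached r x -> reached (r + 4) (sweep x).
Proof.
move=> r1 rN hx.
have lol : {subset lo <= l} by move=> i; rewrite mem_filter => /andP[].
have lel : {subset le <= l} by move=> i; rewrite mem_filter => /andP[].
have lo_odd : {in lo, forall i, odd (pos i) = true}.
  by move=> i; rewrite mem_filter => /andP[].
have le_odd : {in le, forall i, odd (pos i) = false}.
  by move=> i; rewrite mem_filter => /andP[/negbTE].
have rlo i : i \in rev lo -> i \in lo by rewrite mem_rev.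
have rle i : i \in rev le -> i \in le by rewrite mem_rev.
have dcat s1 s2 w : damps b (s1 ++ s2) w = damps b s1 (damps b s2 w).
  by rewrite /damps foldr_cat.
have r1' : (r <= N.+1)%N by lia.
have r2' : (r.+1 <= N.+1)%N by lia.
have r3' : (r.+2 <= N.+1)%N by lia.
have r4' : (r.+3 <= N.+1)%N by lia.
have h1 := reached_layer r1 r1' lol lo_odd hx.
have h2 := @reached_layer r.+1 _ _ _ isT r2' lel le_odd h1.
have h3 := @reached_layer r.+2 _ _ _ isT r3' (fun i il => lel i (rle i il))
  (fun i il => le_odd i (rle i il)) h2.
have h4 := @reached_layer r.+3 _ _ _ isT r4' (fun i il => lol i (rlo i il))
  (fun i il => lo_odd i (rlo i il)) h3.
by rewrite /sweep rev_cat !dcat addn4.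
Qed.

Lemma light_cone j : (4 * j <= N.+1)%N -> ip phi (iter j sweep psi) = ip phi psi.
Proof.
move=> hj; suff [M [-> -> _]] : reached (4 * j + 1) (iter j sweep psi) by [].
elim: j hj => [_|j IH hj]; first by exists id.
rewrite iterS mulnS -addnA addnC; apply: reached_sweep; try lia.
by apply: IH; lia.
Qed.

Variables (x M : R) (g : nat).
Hypotheses (x_gt0 : 0 < x) (M_gt0 : 0 < M) (g_gt0 : (0 < g)%N).
Hypothesis nb_count : forall i, i \in l -> (count (nb i) l <= g)%N.

Definition excited u := forall k, {in l, forall i, b i k = 0} -> ip k u = 0.

Hypothesis gap_le : forall u, excited u ->
  x * ip u u <= M * \sum_(i <- l) ip (b i u) (b i u).

Lemma excited_damps s u : {subset s <= l} -> excited u -> excited (damps b s u).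
Proof.
move=> sl eu k hk; rewrite (damps_rev b_sym).
rewrite (_ : damps b (rev s) k = k); first exact: eu.
have : {in rev s, forall i, b i k = 0}.
  by move=> i; rewrite mem_rev => /sl; apply: hk.
elim: (rev s) => [//|i s' IH] hs; rewrite /= -/(damps b s' k) IH ?damp_fixed//.
  by apply: hs; rewrite mem_head.
by move=> j js; apply: hs; rewrite inE js orbT.
Qed.

Theorem overlap_bound m : (4 * m <= N.+1)%N -> excited psi ->
  ip phi psi * (1 + m%:R ^+ 2 * (2 * x / (M * g%:R ^+ 2)))
    <= ipnorm ip phi * ipnorm ip psi.
Proof.
move=> mN epsi.
(* Gap and detectability combine to [x |D u|^2 <= eta (|u|^2 - |D u|^2)], whence [a]; then
   [2 / a - 2 = 2 x / eta]. *)
set eta := M * g%:R ^+ 2; pose a := eta / (x + eta).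
have eta0 : 0 < eta by rewrite mulr_gt0// exprn_gt0// ltr0n.
have xe0 : 0 < x + eta by rewrite addr_gt0.
have a0 : 0 < a by rewrite divr_gt0.
set L := le ++ lo.
have perm : perm_eq L l by rewrite /L perm_catC perm_filterC.
have Lu : uniq L by rewrite (perm_uniq perm).
have Ll i : (i \in L) = (i \in l) by rewrite (perm_mem perm).
have damps_le u : excited u -> ip (damps b L u) (damps b L u) <= a * ip u u.
  move=> eu; have /gap_le h : excited (damps b L u).
    by apply: excited_damps => // i; rewrite Ll.
  have /(detectability b_sym b_contr nb_refl nb_sym nb_comm u Lu) h2 :
      forall i, i \in L -> (count (nb i) L <= g)%N.
    by move=> i; rewrite Ll (seq.permP perm) => /nb_count.
  rewrite (perm_big _ perm) /= in h2.
  rewrite /a mulrAC ler_pdivlMr//.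
  have := le_trans h (ler_wpM2l (ltW M_gt0) h2).
  by rewrite mulrA -/eta; lra.
have damps_lin s : linear (damps b s).
  move=> c u v; elim: s => [//|i s IH] /=; rewrite -/(damps b s _) IH /damp !linearP.
  by rewrite scalerDr addrACA.
have sweep_lin : linear sweep by move=> c u v; rewrite /sweep !damps_lin.
pose SS := GRing.isLinear.Build _ _ _ _ sweep sweep_lin.
pose S : {linear W -> W} := HB.pack sweep SS.
have Sadj u v : ip u (S v) = ip (damps b L u) (damps b L v).
  by rewrite /= /sweep (damps_rev b_sym) revK.
have S_sym u v : ip u (S v) = ip (S u) v by rewrite (ipC ip (S u)) !Sadj ipC.
have excitedD u v : excited u -> excited v -> excited (u + v).
  by move=> hu hv k hk; rewrite ipDr hu// hv// addr0.
have excitedZ c u : excited u -> excited (c *: u).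
  by move=> hu k hk; rewrite ipZr hu// mulr0.
have eDD s u : {subset s <= L} -> excited u -> excited (damps b s u).
  by move=> sL; apply: excited_damps => i /sL; rewrite Ll.
have eS u : excited u -> excited (S u).
  have rL : {subset rev L <= L} by move=> i; rewrite mem_rev.
  by move=> eu; exact: (eDD _ _ rL (eDD _ _ (fun _ => id) eu)).
(* Since [|S u|^2 = <D u, D S u>], Cauchy-Schwarz and the contraction bound at [S u] give
   [|S u|^4 <= a |D u|^2 |S u|^2], where [|D u|^2 = <u, S u>]. *)
have S_le u : excited u -> ip (S u) (S u) <= a * ip u (S u).
  move=> eu; rewrite (Sadj u u); set w := damps b L u.
  have h := damps_le _ (eS u eu).
  have e : ip (S u) (S u) = ip w (damps b L (S u)) by rewrite -S_sym Sadj.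
  have := cauchy_schwarz ip w (damps b L (S u)); rewrite -e.
  have [->|p0] := eqVneq (ip (S u) (S u)) 0.
    by move=> _; rewrite mulr_ge0 ?ip_ge0 ?(ltW a0).
  have pp : 0 < ip (S u) (S u) by rewrite lt_neqAle eq_sym p0 ip_ge0.
  move=> h2; rewrite -(ler_pM2l pp) -expr2 (le_trans h2)//.
  rewrite (le_trans (ler_wpM2l (ip_ge0 _ _) h))//.
  lra.
have e0 : excited 0 by move=> k _; rewrite ip0r.
have a1 : a <= 1 by rewrite ler_pdivrMr// mul1r lerDr ltW.
have hit j : (j <= m)%N -> ip phi (iter j S psi) = ip phi psi.
  by move=> jm; rewrite -(@light_cone j)//; lia.
have := chebyshev_bound S_sym e0 excitedD excitedZ eS a0 S_le a1 epsi hit.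
congr (_ * (1 + _ * _) <= _); rewrite /a; field.
by rewrite !lt0r_neq0.
Qed.

End LightCone.

(** * Spectral theory of positive matrices *)

(* [C^n] as a real vector space; its inner product is the real part of the
   Hermitian product. *)
Definition rvec (R : realType) (n : nat) := 'cV[R[i]]_n.
HB.instance Definition _ (R : realType) n := GRing.Zmodule.on (rvec R n).

Section RealVectors.
Variables (R : realType) (n : nat).
Implicit Types (A B : 'M[R[i]]_n) (a : R).

Definition rscale a (v : rvec R n) : rvec R n := a%:C *: (v : 'cV[R[i]]_n).

Lemma rscaleA a b v : rscale a (rscale b v) = rscale (a * b) v.
Proof. by rewrite /rscale scalerA rmorphM. Qed.
Lemma rscale1 : left_id 1 rscale.
Proof. by move=> v; rewrite /rscale rmorph1 scale1r. Qed.
Lemma rscaleDr : right_distributive rscale +%R.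
Proof. by move=> a u v; rewrite /rscale scalerDr. Qed.
Lemma rscaleDl v : {morph rscale^~ v : a b / a + b}.
Proof. by move=> a b; rewrite /rscale rmorphD scalerDl. Qed.

HB.instance Definition _ :=
  GRing.Zmodule_isLmodule.Build R (rvec R n) rscaleA rscale1 rscaleDr rscaleDl.

Definition rip_def (u v : rvec R n) : R := complex.Re ((u^t* *m v) ord0 ord0).

Lemma rip_sum u v : rip_def u v =
  \sum_k (complex.Re (u k ord0) * complex.Re (v k ord0)
          + complex.Im (u k ord0) * complex.Im (v k ord0)).
Proof.
rewrite /rip_def mxE raddf_sum; apply: eq_bigr => k _; rewrite !mxE.
by case: (u k ord0) => a b; case: (v k ord0) => c d /=; ring.
Qed.

Fact rip_sym u v : rip_def u v = rip_def v u.
Proof. by rewrite !rip_sum; apply: eq_bigr => k _; ring. Qed.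

Fact rip_add u v w : rip_def u (v + w) = rip_def u v + rip_def u w.
Proof. by rewrite /rip_def mulmxDr mxE raddfD. Qed.

Fact rip_scale a u v : rip_def u (a *: v) = a * rip_def u v.
Proof.
rewrite /rip_def -scalemxAr mxE.
by case: (_ ord0 ord0) => x y /=; rewrite mul0r subr0.
Qed.

Fact rip_pos u : 0 <= rip_def u u.
Proof.
by rewrite rip_sum sumr_ge0// => k _; rewrite -!expr2 addr_ge0 ?sqr_ge0.
Qed.

Definition rip : inner (rvec R n) := Inner rip_sym rip_add rip_scale rip_pos.

Lemma rip_eq0 (u : rvec R n) : rip u u = 0 -> u = 0.
Proof.
rewrite /= rip_sum => /eqP; rewrite psumr_eq0 => [/allP h|k _]; last first.
  by rewrite -!expr2 addr_ge0 ?sqr_ge0.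
apply/matrixP => k j; rewrite (ord1 j) mxE.
have := h k (mem_index_enum k).
rewrite /= -!expr2 paddr_eq0 ?sqr_ge0// !sqrf_eq0.
by case: (u k ord0) => a b /= /andP[/eqP-> /eqP->].
Qed.

Lemma l2norm_rip (v : rvec R n) : l2norm v = ipnorm rip v.
Proof.
rewrite /l2norm /ipnorm /= rip_sum; congr Num.sqrt; apply: eq_bigr => k _.
by case: (v k ord0) => a b; rewrite /Normc.normc sqr_sqrtr ?addr_ge0 ?sqr_ge0//.
Qed.

Lemma trmxC_mul m p q (A : 'M[R[i]]_(m, p)) (B : 'M[R[i]]_(p, q)) :
  (A *m B)^t* = B^t* *m A^t*.
Proof. by rewrite trmx_mul map_mxM. Qed.

Definition act A (v : rvec R n) : rvec R n := A *m v.

Fact act_linear A : linear (act A).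
Proof. by move=> a u v; rewrite /act mulmxDr -scalemxAr. Qed.

HB.instance Definition _ A :=
  GRing.isLinear.Build R (rvec R n) (rvec R n) *:%R (act A) (act_linear A).

Lemma act_adj A u v : rip u (act A v) = rip (act (A^t*) u) v.
Proof. by rewrite /= /rip_def /act trmxC_mul trmxCK mulmxA. Qed.

Lemma actM A B v : act (A *m B) v = act A (act B v).
Proof. by rewrite /act mulmxA. Qed.

Lemma actB A B v : act (A - B) v = act A v - act B v.
Proof. by rewrite /act mulmxBl. Qed.

Lemma actZ a A v : act (a%:C *: A) v = a *: act A v.
Proof. by rewrite /act -scalemxAl. Qed.

Lemma act_sum (I : Type) (r : seq I) (P : pred I) (F : I -> 'M[R[i]]_n) v :
  act (\sum_(i <- r | P i) F i) v = \sum_(i <- r | P i) act (F i) v.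
Proof. by rewrite /act mulmx_suml. Qed.

(** Functional calculus: for a fixed unitary [P], identities between such matrices reduce to scalar
    identities between the eigenvalues [f j]. *)
Definition specmx (P : 'M[R[i]]_n) (f : 'I_n -> R) :=
  P^t* *m diag_mx (\row_j (f j)%:C) *m P.

Lemma specmx_herm P f : (specmx P f)^t* = specmx P f.
Proof.
rewrite /specmx !trmxC_mul trmxCK mulmxA; congr (_ *m _ *m _).
rewrite tr_diag_mx map_diag_mx; congr diag_mx.
by apply/matrixP => i j; rewrite !mxE; exact: conjc_real.
Qed.

Lemma specmxM P f g : P *m P^t* = 1%:M ->
  specmx P f *m specmx P g = specmx P (fun j => f j * g j).
Proof.
move=> hP; rewrite /specmx !mulmxA.
rewrite -(mulmxA (_ *m diag_mx _) P) hP mulmx1 -(mulmxA _ (diag_mx _)).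
rewrite mulmx_diag; congr (_ *m diag_mx _ *m _).
by apply/matrixP => i j; rewrite !mxE rmorphM.
Qed.

Lemma specmxB P f g : specmx P f - specmx P g = specmx P (fun j => f j - g j).
Proof.
have e : diag_mx (\row_j (f j - g j)%:C) =
    diag_mx (\row_j (f j)%:C) - diag_mx (\row_j (g j)%:C).
  by apply/matrixP => i j; rewrite !mxE rmorphB mulrnBl.
by rewrite /specmx e mulmxBr mulmxBl.
Qed.

Lemma specmxZ P a f : a%:C *: specmx P f = specmx P (fun j => a * f j).
Proof.
have e : diag_mx (\row_j (a * f j)%:C) = a%:C *: diag_mx (\row_j (f j)%:C).
  by apply/matrixP => i j; rewrite !mxE rmorphM mulrnAr.
by rewrite /specmx e -scalemxAr -scalemxAl.
Qed.

Lemma specmx_row P f j : P *m P^t* = 1%:M ->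
  row j P *m specmx P f = (f j)%:C *: row j P.
Proof.
move=> hP; rewrite /specmx !mulmxA -row_mul hP row1 -rowE.
by rewrite row_diag_mx mxE -scalemxAl -rowE.
Qed.

Lemma row_neq0 (P : 'M[R[i]]_n) j : P *m P^t* = 1%:M -> row j P != 0.
Proof.
move=> hP; apply/eqP => h; have := congr1 (row j) hP.
rewrite row_mul h mul0mx => /rowP/(_ j).
by rewrite !mxE eqxx => /eqP; rewrite eq_sym oner_eq0.
Qed.

Lemma spec_specmx P f z : P *m P^t* = 1%:M -> P^t* *m P = 1%:M ->
  spec (specmx P f) z <-> exists j, z = (f j)%:C.
Proof.
move=> hP hP'; split=> [/eigenvalueP[w hw w0]|[j ->]]; last first.
  apply/eigenvalueP; exists (row j P); rewrite ?row_neq0//.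
  exact: specmx_row.
pose y := w *m P^t*.
have yD : y *m diag_mx (\row_j (f j)%:C) = z *: y.
  rewrite /y scalemxAl -hw /specmx !mulmxA -[RHS]mulmxA hP.
  by rewrite mulmx1.
have y0 : y != 0.
  by apply: contra_neq w0 => y0; rewrite -[w]mulmx1 -hP' mulmxA -/y y0 mul0mx.
move: y yD y0 => y yD y0.
have [j yj] : exists j, y ord0 j != 0.
  apply/existsP; apply: contra_neqT y0 => /existsPn h.
  by apply/rowP => j; rewrite [RHS]mxE; have := h j; rewrite negbK => /eqP.
exists j; move/rowP/(_ j): yD; rewrite mul_mx_diag !mxE mulrC.
by move=> /(mulIf yj) ->.
Qed.

Lemma psd_spectral (K : 'M[R[i]]_n) : psd K ->
  exists (P : 'M[R[i]]_n) (f : 'I_n -> R),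
  [/\ P *m P^t* = 1%:M, P^t* *m P = 1%:M, K = specmx P f & forall j, 0 <= f j].
Proof.
move=> [Kherm Kpos]; have /hermitian_normalmx /orthomx_spectralP := Kherm.
have := hermitian_spectral_diag_real Kherm.
set P := spectralmx K; set D := spectral_diag K => Dreal.
have Pu : P \is unitarymx by exact: spectral_unitarymx.
have hP : P *m P^t* = 1%:M by exact/unitarymxP.
have hP' : P^t* *m P = 1%:M.
  by rewrite -(invmx_unitary Pu) mulVmx// unitarymx_unit.
rewrite invmx_unitary// => KE.
pose f j : R := complex.Re (D ord0 j).
have fD : D = \row_j (f j)%:C.
  apply/rowP => j; rewrite mxE /f; apply/esym/RRe_real.
  by move/mxOverP : Dreal; apply.
exists P, f; split=> //; first by rewrite /specmx -fD.
move=> j; pose v := (row j P)^t*.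
have := Kpos v; rewrite {1}/v trmxCK KE fD -/(specmx P f) specmx_row//.
rewrite -scalemxAl mxE.
suff -> : (row j P *m v) ord0 ord0 = 1 by rewrite mulr1 ler0c.
transitivity ((P *m P^t*) j j); last by rewrite hP mxE eqxx.
by rewrite !mxE; apply: eq_bigr => k _; rewrite !mxE.
Qed.

Lemma psd_sqrt K : psd K -> exists2 B : 'M[R[i]]_n, B^t* = B & B *m B = K.
Proof.
move=> /psd_spectral[P [f [hP _ -> f0]]].
exists (specmx P (fun j => Num.sqrt (f j))); first exact: specmx_herm.
rewrite specmxM//; congr specmx; apply/funext => j.
by rewrite -expr2 sqr_sqrtr.
Qed.

(** The eigenvalues of [K^2 - mu K] are [f j (f j - mu)], nonnegative because [f j] is [0] or at
    least [mu]. Writing this matrix as a square lets the bound pass through [extend]. *)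
Lemma gap_sqrt K (mu : R) : psd K -> (mu%:E <= gap K)%E ->
  exists2 B : 'M[R[i]]_n, B^t* = B & B *m B = K *m K - mu%:C *: K.
Proof.
move=> /psd_spectral[P [f [hP hP' -> f0]]] hmu.
have h j : 0 <= f j * f j - mu * f j.
  have [->|fj] := eqVneq (f j) 0; first by rewrite !mulr0 subrr.
  rewrite -mulrBl mulr_ge0// subr_ge0 -lee_fin (le_trans hmu)//.
  apply: ereal_inf_lbound; exists (f j)%:C => //; split.
    by apply/spec_specmx => //; exists j.
  by move/complexI/eqP; rewrite (negbTE fj).
exists (specmx P (fun j => Num.sqrt (f j * f j - mu * f j))).
  exact: specmx_herm.
rewrite !specmxM// specmxZ specmxB; congr specmx; apply/funext => j.
by rewrite -expr2 sqr_sqrtr.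
Qed.

Lemma psd_range K : psd K -> exists G : 'M[R[i]]_n, K = K *m (K *m G).
Proof.
move=> /psd_spectral[P [f [hP _ -> f0]]].
(* With the convention [0^-1 = 0] this is the pseudo-inverse of [K]. *)
exists (specmx P (fun j => (f j)^-1)); rewrite !specmxM//.
congr specmx; apply/funext => j.
have [->|fj] := eqVneq (f j) 0; first by rewrite mul0r.
by rewrite divff ?mulr1.
Qed.

Lemma gap_attained K : psd K -> gap K = +oo%E \/
  exists x : R, [/\ 0 < x, gap K = x%:E &
    exists2 v : rvec R n, v <> 0 & act K v = x *: v].
Proof.
move=> /psd_spectral[P [f [hP hP' KE f0]]].
have [[j0 hj0]|none] := pselect (exists j, f j != 0); last first.
  left; rewrite /gap (_ : [set _ | _ in _] = set0) ?ereal_inf0//.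
  rewrite -subset0 => y [z [+ z0] _]; rewrite KE => /spec_specmx[]// j zj.
  by apply: none; exists j; apply/eqP => fj; apply: z0; rewrite zj fj.
right; have [j fj jmin] := @arg_minP _ _ _ j0 (fun j => f j != 0) f hj0.
exists (f j); split; first by rewrite lt_neqAle eq_sym fj f0.
  apply/eqP; rewrite eq_le; apply/andP; split.
    apply: ereal_inf_lbound; exists (f j)%:C => //; split.
      by rewrite KE; apply/spec_specmx => //; exists j.
    by move/complexI/eqP; rewrite (negbTE fj).
  apply/ereal_infP => y [z [+ z0] <-]; rewrite KE => /spec_specmx[]// k zk.
  rewrite zk /= lee_fin jmin//; apply/eqP => fk; apply: z0.
  by rewrite zk fk.
exists ((row j P)^t*).
  move=> /(congr1 (fun x : 'cV[R[i]]_n => x^t*)); rewrite trmxCK trmx0 map_mx0.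
  by apply/eqP/row_neq0.
rewrite /act KE -specmx_herm -trmxC_mul specmx_row//.
by apply/matrixP => i k; rewrite !mxE rmorphM; congr (_ * _); exact: conjc_real.
Qed.

End RealVectors.

(** * Extension of local operators *)

Section Extend.
Variables (R : realType) (V : choiceType) (d : nat).
Implicit Types X Y Z : {fset V}.

Definition agree_off X Y (s t : config d Y) :=
  [forall y : Y, (val y \notin X) ==> (s y == t y)].

Definition glue X Y (s : config d Y) (a : config d X) : config d Y :=
  [ffun y => if insub (val y) is Some x then a x else s y].

Lemma agree_offP X Y (s t : config d Y) :
  reflect (forall y, val y \notin X -> s y = t y) (agree_off X s t).
Proof.
apply: (iffP forallP) => [h y yX|h y].
  by have /implyP/(_ yX)/eqP := h y.
by apply/implyP => /h ->.
Qed.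

Lemma restrictE X Y (XY : (X `<=` Y)%fset) (s : config d Y) x :
  Defs.restrict XY s x = s (fincl XY x).
Proof. by rewrite ffunE. Qed.

Lemma glue_out X Y (s : config d Y) (a : config d X) y :
  val y \notin X -> glue s a y = s y.
Proof. by move=> yX; rewrite ffunE insubN. Qed.

Lemma glue_in X Y (XY : (X `<=` Y)%fset) (s : config d Y) (a : config d X) x :
  glue s a (fincl XY x) = a x.
Proof.
rewrite ffunE insubT /=; first exact: valP.
by move=> p; congr (a _); apply: val_inj.
Qed.

Lemma agree_restrict X Y (XY : (X `<=` Y)%fset) (s t : config d Y) :
  agree_off X s t -> Defs.restrict XY s = Defs.restrict XY t -> s = t.
Proof.
move=> /agree_offP h e; apply/ffunP => y.
have [yX|/h//] := boolP (val y \in X).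
have -> : y = fincl XY [` yX]%fset by apply: val_inj.
by rewrite -!restrictE e.
Qed.

Lemma extendE X Y (XY : (X `<=` Y)%fset) (A : op R d X) a b :
  extend XY A a b = if agree_off X (enum_val a) (enum_val b)
    then A (enum_rank (Defs.restrict XY (enum_val a)))
           (enum_rank (Defs.restrict XY (enum_val b))) else 0.
Proof. by rewrite mxE. Qed.

Lemma extendB X Y (XY : (X `<=` Y)%fset) (A B : op R d X) :
  extend XY (A - B) = extend XY A - extend XY B.
Proof.
by apply/matrixP => a b; rewrite !mxE /=; case: ifP => _; rewrite ?subr0// !mxE.
Qed.

Lemma extendZ X Y (XY : (X `<=` Y)%fset) c (A : op R d X) :
  extend XY (c *: A) = c *: extend XY A.
Proof.
apply/matrixP => a b; rewrite [RHS]mxE !extendE.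
by case: ifP => _; rewrite ?mulr0// !mxE.
Qed.

Lemma extend_sum X Y (XY : (X `<=` Y)%fset) (I : Type) (r : seq I) (P : pred I)
    (F : I -> op R d X) :
  extend XY (\sum_(i <- r | P i) F i) = \sum_(i <- r | P i) extend XY (F i).
Proof.
apply/matrixP => a b; rewrite extendE [RHS]summxE; case: ifP => h.
  by rewrite summxE; apply: eq_bigr => i _; rewrite extendE h.
by rewrite big1// => i _; rewrite extendE h.
Qed.

Lemma extend_adj X Y (XY : (X `<=` Y)%fset) (A : op R d X) :
  (extend XY A)^t* = extend XY (A^t*).
Proof.
have e m (M : 'M[R[i]]_m) a b : M^t* a b = Num.conj_op (M b a) by rewrite !mxE.
apply/matrixP => a b; rewrite e !extendE e.
have -> : agree_off X (enum_val b) (enum_val a) = agree_off X (enum_val a) (enum_val b).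
  by apply/agree_offP/agree_offP => h y /h.
by case: ifP => // _; rewrite rmorph0.
Qed.

Lemma extend_comp X Y Z (XY : (X `<=` Y)%fset) (YZ : (Y `<=` Z)%fset)
    (XZ : (X `<=` Z)%fset) (A : op R d X) :
  extend YZ (extend XY A) = extend XZ A.
Proof.
apply/matrixP => a b; rewrite !extendE !enum_rankK.
set s := enum_val a; set t := enum_val b.
have rr u : Defs.restrict XY (Defs.restrict YZ u) = Defs.restrict XZ u.
  by apply/ffunP => x; rewrite !ffunE; congr (u _); apply: val_inj.
rewrite !rr; have <- : agree_off Y s t
    && agree_off X (Defs.restrict YZ s) (Defs.restrict YZ t) = agree_off X s t.
  apply/andP/agree_offP => [[/agree_offP hY /agree_offP hX] z zX|h].
    have [zY|/hY//] := boolP (val z \in Y).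
    have -> : z = fincl YZ [` zY]%fset by apply: val_inj.
    by rewrite -!restrictE hX.
  split; apply/agree_offP => y hy; last by rewrite !restrictE h.
  by apply: h; apply: contra hy; apply: (fsubsetP XY).
by case: (agree_off Y s t) => //=; case: ifP.
Qed.

Lemma extendM X Y (XY : (X `<=` Y)%fset) (A B : op R d X) :
  extend XY (A *m B) = extend XY A *m extend XY B.
Proof.
apply/matrixP => a c; rewrite extendE [RHS]mxE.
set s := enum_val a; set u := enum_val c.
under [RHS]eq_bigr => b _ do rewrite !extendE -/s -/u.
have [su|su] := ifP; last first.
  rewrite big1// => b _; case: ifP => [/agree_offP sb|]; last by rewrite mul0r.
  case: ifP => [/agree_offP bu|]; last by rewrite mulr0.
  case/negP: (negbT su); apply/agree_offP => y yX.
  by rewrite sb ?bu.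
rewrite mxE [RHS](bigID (fun b => agree_off X s (enum_val b))) /= [X in _ = _ + X]big1 ?addr0; last first.
  by move=> b; case: ifP => // _ _; rewrite mul0r.
(* The intermediate configurations agreeing with [s] off [X] are exactly the [glue s k], with [k] a
   configuration of [X]. *)
rewrite [RHS](reindex_onto (fun k => enum_rank (glue s (enum_val k)))
  (fun b => enum_rank (Defs.restrict XY (enum_val b)))) /=; last first.
  move=> b sb; rewrite enum_rankK -[RHS]enum_valK; congr enum_rank.
  apply: (@agree_restrict X _ XY).
    apply/agree_offP => y yX; rewrite glue_out//.
    by move/agree_offP : sb; apply.
  by apply/ffunP => x; rewrite ffunE glue_in.
have r_glue k : Defs.restrict XY (glue s k) = k.
  by apply/ffunP => x; rewrite ffunE glue_in.
have s_glue (k : config d X) : agree_off X s (glue s k).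
  by apply/agree_offP => y yX; rewrite glue_out.
apply: eq_big => [k|k _]; rewrite !enum_rankK r_glue s_glue enum_valK ?eqxx//.
suff -> : agree_off X (glue s (enum_val k)) u by [].
by apply/agree_offP => y yX; rewrite glue_out//; move/agree_offP : su; apply.
Qed.

(** A single intermediate configuration contributes: the column's values on [X] and the row's
    elsewhere. The resulting formula is symmetric in the two factors, which gives commutation. *)
Lemma extend_mul_disjoint X Y Z (XZ : (X `<=` Z)%fset) (YZ : (Y `<=` Z)%fset)
    (A : op R d X) (B : op R d Y) a c : [disjoint X & Y]%fset ->
  (extend XZ A *m extend YZ B) a c =
  if agree_off (X `|` Y)%fset (enum_val a) (enum_val c) then
    A (enum_rank (Defs.restrict XZ (enum_val a)))
      (enum_rank (Defs.restrict XZ (enum_val c))) *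
    B (enum_rank (Defs.restrict YZ (enum_val a)))
      (enum_rank (Defs.restrict YZ (enum_val c))) else 0.
Proof.
move=> /fdisjointP dXY; rewrite mxE.
set s := enum_val a; set u := enum_val c.
under eq_bigr => b _ do rewrite !extendE -/s -/u.
pose t0 := glue s (Defs.restrict XZ u).
rewrite (bigD1 (enum_rank t0)) //= big1 ?addr0; last first.
  move=> b bt0; case: ifP => [/agree_offP sb|]; last by rewrite mul0r.
  case: ifP => [/agree_offP bu|]; last by rewrite mulr0.
  case/negP: bt0; apply/eqP; rewrite -[LHS]enum_valK; congr enum_rank.
  apply/ffunP => z; have [zX|zX] := boolP (val z \in X); last first.
    by rewrite glue_out// -sb.
  have ez : z = fincl XZ [` zX]%fset by apply: val_inj.
  by rewrite bu ?dXY// {2}ez glue_in restrictE -ez.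
rewrite enum_rankK.
have -> : agree_off X s t0 by apply/agree_offP => z zX; rewrite glue_out.
have -> : Defs.restrict XZ t0 = Defs.restrict XZ u.
  by apply/ffunP => x; rewrite ffunE glue_in.
have -> : Defs.restrict YZ t0 = Defs.restrict YZ s.
  apply/ffunP => y; rewrite !ffunE insubN//.
  by apply: contraL (valP y) => /dXY.
have -> : agree_off Y t0 u = agree_off (X `|` Y)%fset s u.
  apply/agree_offP/agree_offP => h z.
    rewrite inE negb_or => /andP[zX zY]; rewrite -h//.
    by rewrite glue_out.
  move=> zY; have [zX|zX] := boolP (val z \in X).
    have ez : z = fincl XZ [` zX]%fset by apply: val_inj.
    by rewrite {1}ez glue_in restrictE -ez.
  by rewrite glue_out// h// inE negb_or zX.
by case: ifP => // _; rewrite mulr0.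
Qed.

Lemma extend_comm X Y Z (XZ : (X `<=` Z)%fset) (YZ : (Y `<=` Z)%fset)
    (A : op R d X) (B : op R d Y) : [disjoint X & Y]%fset ->
  extend XZ A *m extend YZ B = extend YZ B *m extend XZ A.
Proof.
move=> dXY; apply/matrixP => a c; rewrite !extend_mul_disjoint//.
  by rewrite fsetUC mulrC.
by rewrite fdisjoint_sym.
Qed.

End Extend.

(** * Kernels and gaps as positivity statements *)

Section PsdFacts.
Variables (R : realType) (n : nat).
Implicit Types (K B : 'M[R[i]]_n) (u v : rvec R n).

Lemma hermP K : K \is hermsymmx <-> K^t* = K.
Proof.
by split=> [/is_hermitianmxP|h]; last apply/is_hermitianmxP;
  rewrite expr0 scale1r.
Qed.

Lemma psd_herm K : psd K -> K^t* = K.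
Proof. by case=> /hermP. Qed.

Lemma psd_sq B : B^t* = B -> psd (B *m B).
Proof.
move=> hB; split; first by apply/hermP; rewrite trmxC_mul hB.
move=> v; rewrite mulmxA -{1}hB -trmxC_mul -mulmxA mxE sumr_ge0// => k _.
by rewrite !mxE mulrC mul_conjC_ge0.
Qed.

Lemma psd_sum (I : Type) (r : seq I) (P : pred I) (F : I -> 'M[R[i]]_n) :
  (forall i, P i -> psd (F i)) -> psd (\sum_(i <- r | P i) F i).
Proof.
move=> h; elim/big_rec : _ => [|i K /h[Fh Fp] [Kh Kp]].
  rewrite -(mulmx0 n (0 : 'M[R[i]]_n)); apply: psd_sq.
  by rewrite trmx0 map_mx0.
split.
  apply/hermP; move/hermP : Fh => {2}<-; move/hermP : Kh => {2}<-.
  by rewrite linearD map_mxD.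
by move=> v; rewrite mulmxDr mulmxDl mxE addr_ge0.
Qed.

(* Every eigenvalue of [K] is [0] or at least [mu]; unlike the gap, this is a
   positivity statement and so survives tensoring with the identity. *)
Definition quad_gap K (mu : R) := forall v,
  mu * rip R n v (act K v) <= rip R n (act K v) (act K v).

Lemma quad_gap_sq K B mu : K^t* = K -> B^t* = B ->
  B *m B = K *m K - mu%:C *: K -> quad_gap K mu.
Proof.
move=> hK hB e v; rewrite -subr_ge0 -{1}hK -act_adj -actM -ipZr -ipBr.
by rewrite -actZ -actB -e actM act_adj hB ip_ge0.
Qed.

Lemma gap_quad_gap K mu : psd K -> (mu%:E <= gap K)%E -> quad_gap K mu.
Proof.
by move=> pK /(gap_sqrt pK)[B hB e]; apply: quad_gap_sq e => //; exact: psd_herm.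
Qed.

(** [a] is the orthogonal projection of [v] onto the kernel of [K], and the last clause is
    [K >= mu (1 - projection)]. *)
Lemma ker_split K mu v : psd K -> quad_gap K mu -> exists a,
  [/\ act K a = 0, forall k, act K k = 0 -> rip R n k (v - a) = 0 &
      mu * rip R n (v - a) (v - a) <= rip R n v (act K v)].
Proof.
move=> pK hmu; have hK := psd_herm pK.
have [G KG] := psd_range pK; have [B hB KB] := psd_sqrt pK.
set w := act G v; pose a := v - act K w.
have e : act K (act K w) = act K v by rewrite /w {3}KG !actM.
have Ka : act K a = 0.
  by rewrite /a linearB /= e subrr.
have va : v - a = act K w by rewrite /a opprB addrC subrK.
exists a; split=> //.
  by move=> k Kk; rewrite va act_adj hK Kk ipC ip0r.
have -> : rip R n v (act K v) = rip R n (act K w) (act K (act K w)).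
  by rewrite -{1}e act_adj hK -e ipC.
(* Here [v - a = K w]. Evaluating [quad_gap] at [sqrt(K) w] turns its two sides into [mu |K w|^2]
   and [<K w, K K w>]. *)
have := hmu (act B w); rewrite va.
have -> : rip R n (act B w) (act K (act B w)) = rip R n (act K w) (act K w).
  by rewrite -KB !actM [RHS]act_adj hB ipC.
have -> // : rip R n (act K (act B w)) (act K (act B w)) =
    rip R n (act K w) (act K (act K w)).
have -> : act K (act B w) = act B (act K w) by rewrite -KB !actM.
by rewrite act_adj hB -actM KB ipC.
Qed.

Lemma ker_energy0 K v : psd K -> rip R n v (act K v) = 0 -> act K v = 0.
Proof.
move=> /psd_sqrt[B hB <-]; rewrite actM act_adj hB => /rip_eq0 ->.
exact: linear0.
Qed.

Lemma psd_sqrt_contr K (M : R) : 0 < M -> psd K ->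
  (forall v, rip R n (act K v) (act K v) <= M ^+ 2 * rip R n v v) ->
  exists B C : 'M[R[i]]_n, [/\ B^t* = B, C^t* = C, M%:C *: (B *m B) = K &
    C *m C = 1%:M - B *m B].
Proof.
move=> M0 /psd_spectral[P [f [hP hP' KE f0]]] hM.
have fM j : f j <= M.
  pose v : rvec R n := (row j P)^t*.
  have Kv : act K v = f j *: v.
    rewrite /act KE -specmx_herm -trmxC_mul specmx_row//.
    by apply/matrixP => i k; rewrite !mxE rmorphM; congr (_ * _); exact: conjc_real.
  have v0 : 0 < rip R n v v.
    rewrite lt_neqAle ip_ge0 andbT; apply/eqP => /esym/rip_eq0.
    move=> /(congr1 (fun x : 'cV[R[i]]_n => x^t*)); rewrite trmxCK trmx0 map_mx0.
    by apply/eqP/row_neq0.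
  have := hM v; rewrite Kv ipZl ipZr mulrA -expr2 ler_pM2r//.
  by rewrite ler_pXn2r ?nnegrE ?f0 ?(ltW M0).
have h1 : 1%:M = specmx P (fun=> 1).
  rewrite /specmx (_ : diag_mx _ = 1%:M) ?mulmx1//.
  by apply/matrixP => i j; rewrite !mxE.
exists (specmx P (fun j => Num.sqrt (f j / M))).
exists (specmx P (fun j => Num.sqrt (1 - f j / M))).
have d0 j : 0 <= f j / M by rewrite divr_ge0 ?(ltW M0).
split; [exact: specmx_herm | exact: specmx_herm | |].
- rewrite (specmxM _ _ hP) specmxZ KE; congr specmx; apply/funext => j.
  by rewrite -expr2 sqr_sqrtr// mulrCA divff ?mulr1// gt_eqF.
- rewrite !(specmxM _ _ hP) h1 specmxB; congr specmx; apply/funext => j.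
  rewrite -!expr2 !sqr_sqrtr//.
  by rewrite subr_ge0 ler_pdivrMr// mul1r.
Qed.

End PsdFacts.

(** * Positivity and gaps under extension *)

Section ExtendGap.
Variables (R : realType) (V : choiceType) (d : nat).
Implicit Types X Y : {fset V}.

Lemma extend1 X Y (XY : (X `<=` Y)%fset) : extend XY (1%:M : op R d X) = 1%:M.
Proof.
apply/matrixP => a b; rewrite extendE !mxE.
have [->|ab] := eqVneq a b.
  have h (t : config d Y) : agree_off X t t by apply/agree_offP.
  by rewrite h eqxx.
case: ifP => // sb; case: eqP => // /enum_rank_inj /(agree_restrict sb).
by move=> /enum_val_inj /eqP; rewrite (negbTE ab).
Qed.

Lemma psd_extend X Y (XY : (X `<=` Y)%fset) (K : op R d X) :
  psd K -> psd (extend XY K).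
Proof.
by move=> /psd_sqrt[B hB <-]; rewrite extendM; apply: psd_sq; rewrite extend_adj hB.
Qed.

Lemma quad_gap_extend X Y (XY : (X `<=` Y)%fset) (K : op R d X) (mu : R) :
  psd K -> (mu%:E <= gap K)%E -> quad_gap (extend XY K) mu.
Proof.
move=> pK /(gap_sqrt pK)[B hB e].
apply: (@quad_gap_sq _ _ _ (extend XY B)); rewrite ?extend_adj ?hB ?psd_herm//.
by rewrite -extendM e extendB extendM extendZ.
Qed.

End ExtendGap.

(** * The overlap of two ground spaces *)

Section Terms.
Variables (R : realType) (V : choiceType) (d : nat).
Variables (Phi : interaction R V d) (M : R).
Hypothesis M_gt0 : 0 < M.
Hypothesis Phi_psd : forall X, psd (Phi X).
Hypothesis Phi_le : forall X v,
  rip _ _ (act (Phi X) v) (act (Phi X) v) <= M ^+ 2 * rip R _ v v.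
Implicit Types (X Y A B L : {fset V}).

Lemma extend_id L (LL : (L `<=` L)%fset) (K : op R d L) : extend LL K = K.
Proof.
have rr u : Defs.restrict LL u = u.
  by apply/ffunP => x; rewrite ffunE; congr (u _); apply: val_inj.
apply/matrixP => a b; rewrite extendE !rr !enum_valK (_ : agree_off L _ _)//.
by apply/agree_offP => y; rewrite (valP y).
Qed.

(* [extend] made total, so that terms can be indexed by arbitrary finite sets. *)
Definition ext0 L X (K : op R d X) : op R d L :=
  if pselect (X `<=` L)%fset is left h then extend h K else 0.

Lemma ext0E L X (XL : (X `<=` L)%fset) (K : op R d X) : ext0 L K = extend XL K.
Proof.
by rewrite /ext0; case: pselect => // h; congr extend; apply: bool_irrelevance.
Qed.

Lemma ext0_out L X (K : op R d X) : ~~ (X `<=` L)%fset -> ext0 L K = 0.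
Proof. by move=> /negP h; rewrite /ext0; case: pselect. Qed.

Definition is_root X : set (op R d X) := [set B |
  [/\ B^t* = B, M%:C *: (B *m B) = Phi X &
      exists2 C : op R d X, C^t* = C & C *m C = 1%:M - B *m B]].

Definition root X : op R d X := xget 0 (@is_root X).

Lemma rootP X : is_root (root X).
Proof.
have [B [C [hB hC e eC]]] := psd_sqrt_contr M_gt0 (Phi_psd X) (@Phi_le X).
have rB : is_root B by split=> //; exists C.
exact: xgetI rB.
Qed.

Local Notation term L X := (act (ext0 L (root X))).

Lemma term_out L X v : ~~ (X `<=` L)%fset -> term L X v = 0.
Proof. by move=> h; rewrite ext0_out// /act mul0mx. Qed.

Lemma term_sym L X u v : rip R _ u (term L X v) = rip R _ (term L X u) v.
Proof.
have [h|h] := boolP (X `<=` L)%fset; last by rewrite !term_out// ip0r ipC ip0r.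
by rewrite act_adj !(ext0E h) extend_adj; have [-> _ _] := rootP X.
Qed.

Lemma term_contr L X v :
  rip R _ (term L X v) (term L X v) <= rip R _ v v.
Proof.
have [h|h] := boolP (X `<=` L)%fset; last by rewrite !term_out// ip0r ip_ge0.
have [_ _ [C hC e]] := rootP X.
rewrite -subr_ge0 -term_sym -ipBr (ext0E h) -actM.
have -> : v - act (extend h (root X) *m extend h (root X)) v =
    act (extend h C *m extend h C) v.
  by rewrite -!extendM e extendB extend1 actB [act 1%:M v]mul1mx.
by rewrite actM act_adj extend_adj hC ip_ge0.
Qed.

(** The first clause makes the relation reflexive at the empty set, which is disjoint from
    itself. *)
Definition touch X Y := (X == Y) || ~~ [disjoint X & Y]%fset.

Lemma touch_refl : reflexive touch.
Proof. by move=> X; rewrite /touch eqxx. Qed.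

Lemma touch_sym : symmetric touch.
Proof. by move=> X Y; rewrite /touch eq_sym fdisjoint_sym. Qed.

Lemma term_comm L X Y v : ~~ touch X Y ->
  term L X (term L Y v) = term L Y (term L X v).
Proof.
rewrite negb_or negbK => /andP[_ dXY].
have [hX|hX] := boolP (X `<=` L)%fset; last by rewrite !(term_out _ hX) linear0.
have [hY|hY] := boolP (Y `<=` L)%fset; last by rewrite !(term_out _ hY) linear0.
by rewrite (ext0E hX) (ext0E hY) -!actM extend_comm.
Qed.

Lemma term_energy L X v : (X `<=` L)%fset ->
  rip R _ v (act (ext0 L (Phi X)) v) =
  M * rip R _ (term L X v) (term L X v).
Proof.
move=> h; rewrite -term_sym -ipZr; congr (rip _ _ _ _).
have [_ <- _] := rootP X.
by rewrite !(ext0E h) extendZ extendM actZ actM.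
Qed.

Lemma ip_sumr (n : nat) (I : Type) (r : seq I) (P : pred I) (u : rvec R n)
    (F : I -> rvec R n) :
  rip R n u (\sum_(i <- r | P i) F i) = \sum_(i <- r | P i) rip R n u (F i).
Proof.
elim/big_rec2: _ => [|i x y _ <-]; first exact: ip0r.
exact: ipDr.
Qed.

Lemma ham_energy A L (AL : (A `<=` L)%fset) v :
  rip R _ v (act (extend AL (hamiltonian Phi A)) v) =
  M * \sum_(X <- fpowerset A) rip R _ (term L X v) (term L X v).
Proof.
rewrite /hamiltonian extend_sum act_sum ip_sumr big_distrr/= [RHS]big_seq_fsetE/=.
apply: eq_bigr => X _.
have XL : (val X `<=` L)%fset := fsubset_trans (fpowerset_sub X) AL.
by rewrite -(term_energy _ XL) (ext0E XL) (extend_comp (fpowerset_sub X) AL XL).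
Qed.

Lemma psd_ham A : psd (hamiltonian Phi A).
Proof. by apply: psd_sum => X _; apply: psd_extend. Qed.

Definition terms L := [seq X <- fpowerset L | Phi X != 0].

Lemma terms_sub L X : X \in terms L -> (X `<=` L)%fset.
Proof. by rewrite mem_filter fpowersetE => /andP[]. Qed.

Lemma sum_terms A L (v : rvec R #|config d L|) : (A `<=` L)%fset ->
  \sum_(X <- fpowerset A) rip R _ (term L X v) (term L X v) =
  \sum_(X <- terms L | (X `<=` A)%fset) rip R _ (term L X v) (term L X v).
Proof.
move=> AL; rewrite (bigID (fun X => Phi X != 0)) /= addrC big1_seq ?add0r.
  rewrite -big_filter -[RHS]big_filter; apply: perm_big; apply: uniq_perm.
  - by rewrite filter_uniq ?fset_uniq.
  - by rewrite !filter_uniq ?fset_uniq.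
  move=> X; rewrite !mem_filter !fpowersetE andbC.
  have [XA|XA] := boolP (X `<=` A)%fset => //=.
  by rewrite (fsubset_trans XA AL) andbT.
move=> X /andP[/negPn/eqP X0]; rewrite fpowersetE => XA.
have XL := fsubset_trans XA AL.
have := term_energy v XL.
have -> : ext0 L (Phi X) = 0 by rewrite X0 (ext0E XL) -[0](scale0r 0) extendZ scale0r.
rewrite [act 0 v]mul0mx ip0r => /esym/eqP.
by rewrite mulf_eq0 (gt_eqF M_gt0) => /eqP.
Qed.

Lemma ham_energy_terms A L (AL : (A `<=` L)%fset) v :
  rip R _ v (act (extend AL (hamiltonian Phi A)) v) =
  M * \sum_(X <- terms L | (X `<=` A)%fset) rip R _ (term L X v) (term L X v).
Proof. by rewrite ham_energy sum_terms. Qed.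

(** The energy is [M] times a sum of squares, so it vanishes only when each square does. *)
Lemma ham_ker A L (AL : (A `<=` L)%fset) v :
  act (extend AL (hamiltonian Phi A)) v = 0 <->
  {in terms L, forall X, (X `<=` A)%fset -> term L X v = 0}.
Proof.
have pA := psd_extend AL (psd_ham A).
split=> [h X XL XA|h].
  have /eqP : rip R _ v (act (extend AL (hamiltonian Phi A)) v) = 0 by rewrite h ip0r.
  rewrite ham_energy_terms mulf_eq0 (gt_eqF M_gt0) orFb.
  rewrite psumr_eq0 => [/allP/(_ X XL)|Y _]; last by rewrite ip_ge0.
  by rewrite XA implyTb => /eqP /rip_eq0.
apply: ker_energy0 => //; rewrite ham_energy_terms big1_seq ?mulr0// => X.
by move=> /andP[XA XL]; rewrite h// ip0r.
Qed.

(** Let [a] and [b] be the projections of [v] onto the ground spaces of [A] and [B]. The energies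
    are at least [mu |v - a|^2] and [mu |v - b|^2], with sum [mu (2 |v|^2 - |a|^2 - |b|^2)]; the
    small overlap of [a] and [b] bounds [|a|^2 + |b|^2]. *)
Lemma cut_bound (L A B : {fset V}) (AL : (A `<=` L)%fset) (BL : (B `<=` L)%fset)
    (g N m : nat) (pos : {fset V} -> nat) (x mu : R) v :
  0 < x -> (x%:E <= gap (hamiltonian Phi L))%E ->
  0 <= mu -> (mu%:E <= gap (hamiltonian Phi A))%E ->
  (mu%:E <= gap (hamiltonian Phi B))%E ->
  (0 < g)%N -> {in terms L, forall X, (count (touch X) (terms L) <= g)%N} ->
  {in terms L &, forall X Y, touch X Y -> (pos X <= (pos Y).+1)%N} ->
  {in terms L, forall X, (1 <= pos X)%N -> (X `<=` B)%fset} ->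
  {in terms L, forall X, (pos X <= N)%N -> (X `<=` A)%fset} ->
  (4 * m <= N.+1)%N ->
  (forall k, act (hamiltonian Phi L) k = 0 -> rip R _ k v = 0) ->
  mu * (1 - (1 + m%:R ^+ 2 * (2 * x / (M * g%:R ^+ 2)))^-1) * rip R _ v v <=
  rip R _ v (act (extend AL (hamiltonian Phi A)) v) +
  rip R _ v (act (extend BL (hamiltonian Phi B)) v).
Proof.
move=> x0 gapL mu0 gapA gapB g0 hg hpos hB hA hm vk.
set KA := extend AL _; set KB := extend BL _.
have LL : (L `<=` L)%fset by [].
have HLker k : act (hamiltonian Phi L) k = 0 <-> {in terms L, forall X, term L X k = 0}.
  rewrite -[X in act X k](extend_id LL) ham_ker; split=> h X XL; last by move=> _; apply: h.
  exact: h XL (terms_sub XL).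
have pA : psd KA := psd_extend AL (psd_ham A).
have pB : psd KB := psd_extend BL (psd_ham B).
have [a [KAa aperp hAa]] := ker_split v pA (quad_gap_extend AL (psd_ham A) gapA).
have [b [KBb bperp hBb]] := ker_split v pB (quad_gap_extend BL (psd_ham B) gapB).
pose exc := excited (rip R #|config d L|) (fun X => term L X) (terms L).
(* A ground state of [L] is one of [C], hence orthogonal to [v - c]; it is orthogonal to [v] by
   assumption, so also to [c]. *)
have exc_of c (C : {fset V}) (CL : (C `<=` L)%fset) :
    (forall k, act (extend CL (hamiltonian Phi C)) k = 0 -> rip R _ k (v - c) = 0) ->
    exc c.
  move=> h k hk; have := vk k ((HLker k).2 hk).
  have : rip R _ k (v - c) = 0 by apply: h; apply/ham_ker => X XL _; apply: hk.
  by rewrite ipBr => /eqP; rewrite subr_eq0 => /eqP ->.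
have ea : exc a by apply: (exc_of a A AL).
have eb : exc b by apply: (exc_of b B BL).
have fa : {in terms L, forall X, (pos X <= N)%N -> term L X a = 0}.
  by move=> X XL pX; apply: ((ham_ker AL a).1 KAa) => //; apply: hA.
have fb : {in terms L, forall X, (1 <= pos X)%N -> term L X b = 0}.
  by move=> X XL pX; apply: ((ham_ker BL b).1 KBb) => //; apply: hB.
have gap_le u : exc u ->
    x * rip R _ u u <= M * \sum_(X <- terms L) rip R _ (term L X u) (term L X u).
  move=> eu.
  have -> : M * \sum_(X <- terms L) rip R _ (term L X u) (term L X u) =
      rip R _ u (act (hamiltonian Phi L) u).
    rewrite -[X in act X u](extend_id LL) ham_energy_terms; congr (M * _).
    rewrite big_seq [RHS]big_seq_cond; apply: eq_bigl => X.
    by case XL : (X \in _) => //=; rewrite terms_sub.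
  have [c [Kc cperp hc]] := ker_split u (psd_ham L) (gap_quad_gap (psd_ham L) gapL).
  have c0 : c = 0.
    apply: rip_eq0; have := cperp c Kc; rewrite ipBr (eu c); last exact/HLker.
    by rewrite sub0r => /eqP; rewrite oppr_eq0 => /eqP.
  by rewrite c0 subr0 in hc.
have ov := overlap_bound (fun X => @term_sym L X) (@term_contr L) (filter_uniq _ (fset_uniq _))
  touch_refl touch_sym (@term_comm L) hpos fb fa x0 M_gt0 g0 hg gap_le hm eb.
set q := 1 + _ in ov *.
have q1 : 1 <= q.
  rewrite lerDl mulr_ge0 ?exprn_ge0 ?ler0n// divr_ge0//; first by rewrite mulr_ge0 ?ltW.
  by rewrite mulr_ge0 ?exprn_ge0 ?ler0n ?ltW.
have q0 : 0 < q by exact: lt_le_trans q1.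
have va : rip R _ v a = rip R _ a a.
  by have := aperp a KAa; rewrite ipBr => /eqP; rewrite subr_eq0 ipC => /eqP.
have vb : rip R _ v b = rip R _ b b.
  by have := bperp b KBb; rewrite ipBr => /eqP; rewrite subr_eq0 ipC => /eqP.
have := two_projections (ip := rip R _) (v := v) (a := a) (b := b) (delta := q^-1).
rewrite invr_ge0 (ltW q0) va vb => /(_ isT erefl erefl).
rewrite mulrC ler_pdivlMr// => /(_ ov) h2.
apply: le_trans (lerD hAa hBb); rewrite -mulrDr -mulrA ler_wpM2l//.
have arith (ra rb rv r : R) : ra + rb <= (1 + r) * rv ->
  (1 - r) * rv <= rv - 2 * ra + ra + (rv - 2 * rb + rb) by lra.
by rewrite !ipB_sq va vb; exact: arith h2.
Qed.

End Terms.

(** * Averaging over cuts *)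

(** As [[y < c_(j+1)] = 1 - [c_(j+1) <= y]], the sum telescopes to [s + [c_0 <= y] - [c_s <= y]].
    Disjoint overlaps thus cost [s + 1] in place of [2 s]. *)
Lemma sum_indicator_telescope (R : realDomainType) (c : nat -> R) (y : R) s :
  {homo c : i j / (i <= j)%N >-> i <= j} ->
  (\sum_(j < s) ((y < c j.+1)%R + (c j <= y)%R) <= s.+1)%N.
Proof.
move=> hc; suff : (\sum_(j < s) ((y < c j.+1)%R + (c j <= y)%R) + (c s <= y)%R <= s + 1)%N.
  by rewrite addn1; apply: leq_trans; rewrite leq_addr.
elim: s => [|s IH]; first by rewrite big_ord0; case: (_ <= _).
rewrite big_ord_recr /=.
have : ((y < c s.+1)%R + (c s.+1 <= y)%R = 1)%N by rewrite leNgt; case: (_ < _).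
move: (y < c s.+1) (c s.+1 <= y) (c s <= y) (\sum_(j < s) _)%N IH => b1 b2 b3 S.
by lia.
Qed.

Section GapStep.
Variables (R : realType) (V : choiceType) (d : nat).
Variables (Phi : interaction R V d) (M : R).
Hypothesis M_gt0 : 0 < M.
Hypothesis Phi_psd : forall X, psd (Phi X).
Hypothesis Phi_le : forall X v,
  rip _ _ (act (Phi X) v) (act (Phi X) v) <= M ^+ 2 * rip R _ v v.
Hypothesis Phi0 : Phi fset0 = 0.
Implicit Types (X Y A B L : {fset V}).
Variables (f : V -> R) (rho : R).
Hypothesis rho_gt0 : 0 < rho.
Hypothesis f_diam : forall X, Phi X != 0 ->
  forall i j, i \in X -> j \in X -> f i <= f j + rho.

(** A term is located by an arbitrary one of its sites, since [f] varies by at most [rho] on a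
    nonzero term. The default [0] concerns the empty set, whose term vanishes. *)
Definition first_coord X : R := if enum_fset X is i :: _ then f i else 0.

Lemma first_coordP X : Phi X != 0 -> exists2 i, i \in X & first_coord X = f i.
Proof.
move=> PX; have : X != fset0 by apply: contra_neq PX => ->.
rewrite /first_coord; case E : (enum_fset X) => [|i r] h.
  by case/fset0Pn : h => i; rewrite /in_mem /= /pred_of_finset /= E.
by exists i => //; rewrite -[i \in X]/(i \in enum_fset X) E mem_head.
Qed.

(** Reference sites of touching terms differ by at most [2 rho] in [f], hence the width. The offset
    [rho] places terms of positive slab number entirely above [a]; [truncn] puts everything far to
    the left into slab [0]. *)
Definition slab (a : R) X : nat := Num.truncn ((first_coord X - a + rho) / (2 * rho)).

Definition below L (c : R) : {fset V} := [fset i in L | f i < c]%fset.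
Definition above L (c : R) : {fset V} := [fset i in L | c <= f i]%fset.

Lemma below_sub L c : (below L c `<=` L)%fset.
Proof. by apply/fsubsetP => i; rewrite !inE => /andP[]. Qed.

Lemma above_sub L c : (above L c `<=` L)%fset.
Proof. by apply/fsubsetP => i; rewrite !inE => /andP[]. Qed.

Lemma slab_touch L a : {in terms Phi L &, forall X Y, touch X Y ->
  (slab a X <= (slab a Y).+1)%N}.
Proof.
move=> X Y; rewrite !mem_filter => /andP[PX _] /andP[PY _].
have [i iX fi] := first_coordP PX; have [j jY fj] := first_coordP PY.
case/orP => [/eqP ->//|/fdisjointP h].
have [k kX kY] : exists2 k, k \in X & k \in Y.
  apply: contrapT => hn; apply: h => k kX; apply/negP => kY.
  by apply: hn; exists k.
rewrite /slab fi fj truncn_le_nat.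
have h1 := f_diam PX iX kX; have h2 := f_diam PY kY jY.
have r2 : 0 < 2 * rho by rewrite mulr_gt0.
have hY := truncnS_gt ((f j - a + rho) / (2 * rho)).
rewrite ltr_pdivrMr// in hY; rewrite ltr_pdivrMr// -natr1.
set t := (_.+1)%:R in hY *; lra.
Qed.

Lemma slab_above L a : {in terms Phi L, forall X, (1 <= slab a X)%N ->
  (X `<=` above L a)%fset}.
Proof.
move=> X XL; have := terms_sub XL; move: XL; rewrite mem_filter => /andP[PX _] XL.
have [i iX fi] := first_coordP PX.
rewrite truncn_gt0 fi ler_pdivlMr ?mulr_gt0// => h.
apply/fsubsetP => j jX; rewrite !inE (fsubsetP XL)//=.
by have := f_diam PX iX jX; lra.
Qed.

Lemma slab_below L a c N : a + (2 * rho) * N.+1%:R <= c ->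
  {in terms Phi L, forall X, (slab a X <= N)%N -> (X `<=` below L c)%fset}.
Proof.
move=> hN X XL; have := terms_sub XL; move: XL; rewrite mem_filter => /andP[PX _] XL.
have [i iX fi] := first_coordP PX.
rewrite truncn_le_nat fi ltr_pdivrMr ?mulr_gt0// => h.
apply/fsubsetP => j jX; rewrite !inE (fsubsetP XL)//=.
by have := f_diam PX jX iX; move: N.+1%:R hN h => n hN h; lra.
Qed.

(** A nonzero term contained in a region has a site there, so the telescoping count at one of its
    sites shows that it is used at most [s + 1] times. *)
Lemma cuts_energy L (c : nat -> R) s (v : rvec R #|config d L|) :
  {homo c : i j / (i <= j)%N >-> i <= j} ->
  \sum_(j < s) (rip R _ v (act (extend (below_sub L (c j.+1))
                                  (hamiltonian Phi (below L (c j.+1)))) v) +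
                rip R _ v (act (extend (above_sub L (c j))
                                  (hamiltonian Phi (above L (c j)))) v))
  <= s.+1%:R * rip R _ v (act (hamiltonian Phi L) v).
Proof.
move=> hc; have LL : (L `<=` L)%fset by [].
pose e X : R := rip R _ (act (ext0 L (root Phi M X)) v) (act (ext0 L (root Phi M X)) v).
have e0 X : 0 <= e X by exact: ip_ge0.
have hE A (AL : (A `<=` L)%fset) : rip R _ v (act (extend AL (hamiltonian Phi A)) v) =
    M * \sum_(X <- terms Phi L | (X `<=` A)%fset) e X.
  exact: ham_energy_terms.
rewrite -[X in _ <= _ * rip R _ v (act X v)](extend_id LL) hE.
under eq_bigr => j _ do rewrite !hE -mulrDr.
rewrite -big_distrr /= [leRHS]mulrCA ler_wpM2l ?(ltW M_gt0)//.
rewrite [X in _ <= _ * X](_ : _ = \sum_(X <- terms Phi L) e X); last first.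
  rewrite big_seq_cond [RHS]big_seq; apply: eq_bigl => X.
  by case XL : (X \in _) => //=; rewrite (terms_sub XL).
have split_sum A : \sum_(X <- terms Phi L | (X `<=` A)%fset) e X =
    \sum_(X <- terms Phi L) ((X `<=` A)%fset)%:R * e X.
  by rewrite big_mkcond; apply: eq_bigr => X _; case: ifP; rewrite ?mul1r ?mul0r.
under eq_bigr => j _ do rewrite !split_sum -big_split /=.
rewrite exchange_big /= big_distrr /= big_seq [leRHS]big_seq.
apply: ler_sum => X; rewrite mem_filter => /andP[PX _].
under eq_bigr => j _ do rewrite -mulrDl -natrD.
rewrite -big_distrl /= ler_wpM2r// -natr_sum ler_nat.
have [i iX _] := first_coordP PX.
apply: leq_trans (sum_indicator_telescope (f i) s hc).
apply: leq_sum => j _; apply: leq_add.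
  case h : (_ `<=` _)%fset => //; move/fsubsetP/(_ i iX) : h.
  by rewrite !inE => /andP[_ ->].
case h : (_ `<=` _)%fset => //; move/fsubsetP/(_ i iX) : h.
by rewrite !inE => /andP[_ ->].
Qed.

(** The cut bounds are tested on an eigenvector for the gap [x] of [L] and summed over the cuts. *)
Lemma gap_step L (g m s : nat) (a w mu : R) :
  (0 < g)%N -> {in terms Phi L, forall X, (count (touch X) (terms Phi L) <= g)%N} ->
  (0 < m)%N -> (0 < s)%N -> 8 * rho * m%:R <= w -> 0 <= mu ->
  (forall j, (j < s)%N ->
     (mu%:E <= gap (hamiltonian Phi (below L (a + j.+1%:R * w))))%E /\
     (mu%:E <= gap (hamiltonian Phi (above L (a + j%:R * w))))%E) ->
  ((s%:R / s.+1%:R * mu - M * g%:R ^+ 2 / (2 * m%:R ^+ 2))%:E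
     <= gap (hamiltonian Phi L))%E.
Proof.
move=> g0 hg m0 s0 hw mu0 hgap.
have pL := psd_ham Phi_psd L.
have [->|[x [x0 gapx [v v0 Hv]]]] := gap_attained pL; first exact: leey.
rewrite gapx lee_fin; pose c (j : nat) := a + j%:R * w.
have w0 : 0 <= w by apply: le_trans hw; rewrite !mulr_ge0 ?(ltW rho_gt0).
have hc : {homo c : i j / (i <= j)%N >-> i <= j}.
  by move=> i j ij; rewrite lerD2l ler_wpM2r// ler_nat.
have := cuts_energy s v hc; rewrite Hv ipZr.
set nv := rip R _ v v.
have nv0 : 0 < nv.
  by rewrite lt_neqAle ip_ge0 andbT; apply/eqP => /esym/rip_eq0.
have vk k : act (hamiltonian Phi L) k = 0 -> rip R _ k v = 0.
  move=> hk; have := act_adj (hamiltonian Phi L) k v.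
  rewrite (psd_herm pL) hk Hv ipZr (ipC _ 0) ip0r => /eqP.
  by rewrite mulf_eq0 (gt_eqF x0) => /eqP.
set eta := M * g%:R ^+ 2.
have eta0 : 0 < eta by rewrite mulr_gt0// exprn_gt0// ltr0n.
set q := 1 + m%:R ^+ 2 * (2 * x / eta).
have hj j : (j < s)%N -> mu * (1 - q^-1) * nv <=
    rip R _ v (act (extend (below_sub L (c j.+1)) (hamiltonian Phi (below L (c j.+1)))) v) +
    rip R _ v (act (extend (above_sub L (c j)) (hamiltonian Phi (above L (c j)))) v).
  move=> js; have [gb ga] := hgap j js.
  (* With [N = 4 m - 1] the overlap must hold [4 m] slabs of width [2 rho], which is what
     [8 rho m <= w] provides. *)
  apply: (cut_bound M_gt0 Phi_psd Phi_le (below_sub L (c j.+1)) (above_sub L (c j))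
    (N := (4 * m).-1) (pos := slab (c j)) x0 _ mu0 gb ga g0 hg) => //.
  - by rewrite gapx.
  - exact: slab_touch.
  - exact: slab_above.
  - apply: slab_below; rewrite prednK ?muln_gt0// natrM /c -[j.+1%:R]natr1.
    by move: (j%:R) (m%:R) hw => j' m' hw; lra.
  - by rewrite prednK ?muln_gt0.
move=> hsum.
have {hsum} : s%:R * (mu * (1 - q^-1)) <= s.+1%:R * x.
  rewrite -(ler_pM2r nv0) -[leRHS]mulrA (le_trans _ hsum)//.
  rewrite -mulrA mulr_natl -[X in _ *+ X](card_ord s) -sumr_const.
  by apply: ler_sum => j _; apply: hj.
have m2 : 0 < m%:R ^+ 2 :> R by rewrite exprn_gt0// ltr0n.
have q0 : 0 < q by rewrite addr_gt0// mulr_gt0// divr_gt0// mulr_gt0.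
have -> : 1 - q^-1 = (q - 1) / q by rewrite mulrBl divff ?gt_eqF// mul1r.
(* Because [q - 1] is proportional to [x], a factor [x] cancels from both sides, and what remains is
   linear in [x]. *)
have -> : q - 1 = x * (2 * m%:R ^+ 2 / eta) by rewrite /q; ring.
have -> : s%:R * (mu * (x * (2 * m%:R ^+ 2 / eta) / q)) =
    x * (s%:R * mu * (2 * m%:R ^+ 2) / (eta * q)) by rewrite (invfM eta q); ring.
have eq0 : 0 < eta * q by exact: mulr_gt0.
rewrite [leRHS]mulrC ler_pM2l// ler_pdivrMr// => h.
have s1 : 0 < s.+1%:R :> R by rewrite ltr0n.
have m2' : 0 < 2 * m%:R ^+ 2 :> R by rewrite mulr_gt0.
rewrite lerBlDr mulrAC ler_pdivrMr// -(ler_pM2r m2') (le_trans h)//.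
suff -> : eta * q = (x + eta / (2 * m%:R ^+ 2)) * (2 * m%:R ^+ 2).
  by rewrite mulrCA mulrA.
rewrite mulrDl divfK ?gt_eqF// /q mulrDr mulr1 addrC; congr (_ + _).
transitivity (x * (2 * m%:R ^+ 2) * (eta / eta)); first by ring.
by rewrite divff ?gt_eqF// mulr1.
Qed.

End GapStep.

(** * Packing *)

Section Packing.
Variables (R : realType) (V : choiceType).

Lemma coord_le_eucl_norm D (x : 'rV[R]_D) c : `|x ord0 c| <= eucl_norm x.
Proof.
rewrite -sqrtr_sqr /eucl_norm ler_wsqrtr// (bigD1 c)//= lerDl.
by rewrite sumr_ge0// => j _; rewrite sqr_ge0.
Qed.

Variables (D : nat) (iota : V -> 'rV[R]_D) (C : R).
Hypotheses (D_gt0 : (0 < D)%N) (C_ge1 : 1 <= C).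
Hypothesis separated : forall i j, i != j -> 1 <= C * eucl_norm (iota i - iota j).

(* Points in a common cell of the grid of mesh [1 / (2 C D)] coincide. *)
Lemma packing (a : R) : 0 <= a -> exists P : nat, forall (i0 : V) (s : seq V), uniq s ->
  {in s, forall i c, `|iota i ord0 c - iota i0 ord0 c| <= a} -> (size s <= P)%N.
Proof.
move=> a0; pose K : R := 2 * C * D%:R.
have C0 : 0 < C := lt_le_trans ltr01 C_ge1.
have D0 : 0 < D%:R :> R by rewrite ltr0n.
have K0 : 0 < K by rewrite !mulr_gt0.
pose n := Num.truncn (2 * a * K).
exists #|{ffun 'I_D -> 'I_n.+1}| => i0 s us hs.
pose x i c : R := (iota i ord0 c - iota i0 ord0 c + a) * K.
pose h i : {ffun 'I_D -> 'I_n.+1} := [ffun c => inord (Num.truncn (x i c))].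
have x0 i c : i \in s -> 0 <= x i c.
  move=> /hs/(_ c); rewrite ler_norml => /andP[h1 _].
  by rewrite mulr_ge0 ?(ltW K0)// -lerBlDr sub0r.
have xn i c : i \in s -> (Num.truncn (x i c) <= n)%N.
  move=> /hs/(_ c); rewrite ler_norml => /andP[_ h1].
  by rewrite le_truncn// ler_wpM2r ?(ltW K0)// mulr_natl mulr2n lerD2r.
have hinj : {in s &, injective h}.
  move=> i j si sj hij; apply/eqP/contraT => ij.
  have hc c : (iota i ord0 c - iota j ord0 c) ^+ 2 <= K ^- 2.
    have /(congr1 (@nat_of_ord _)) : h i c = h j c by rewrite hij.
    rewrite !ffunE !inordK ?ltnS ?xn// => e.
    have /andP[i1 i2] := truncn_itv (x0 i c si).
    have /andP[j1 j2] := truncn_itv (x0 j c sj).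
    rewrite e in i1 i2; rewrite -natr1 in i2 j2.
    have hd : (iota i ord0 c - iota j ord0 c) * K = x i c - x j c by rewrite /x; ring.
    have hle : ((iota i ord0 c - iota j ord0 c) * K) ^+ 2 <= 1.
      rewrite hd; have h1 : 0 <= 1 - (x i c - x j c) by lra.
      have h2 : 0 <= 1 + (x i c - x j c) by lra.
      by have := mulr_ge0 h1 h2; lra.
    by rewrite -[K ^- 2]mul1r ler_pdivlMr ?exprn_gt0// -exprMn.
  have := separated ij; rewrite leNgt => /negP; case.
  rewrite -(ltr_pM2l (x := C^-1)) ?invr_gt0// mulKf ?gt_eqF// mulr1.
  rewrite /eucl_norm -[C^-1]ger0_norm ?invr_ge0 ?(ltW C0)// -sqrtr_sqr.
  rewrite ltr_sqrt ?exprn_gt0 ?invr_gt0//.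
  (* The squared distance is at most [D / K^2 = C^-2 / (4 D)], which is below [C^-2]. *)
  apply: (@le_lt_trans _ _ (\sum_(c < D) K ^- 2)).
    by apply: ler_sum => c _; rewrite !mxE.
  rewrite sumr_const card_ord -mulr_natr /K.
  have D1 : 1 <= D%:R :> R by rewrite ler1n.
  rewrite (_ : _ * _ = C^-1 ^+ 2 * (4 * D%:R)^-1); last first.
    by field; rewrite !gt_eqF.
  rewrite gtr_pMr ?exprn_gt0 ?invr_gt0// invf_lt1 ?mulr_gt0//; lra.
rewrite -(size_map h) -(card_uniqP _) ?map_inj_in_uniq//.
exact: max_card.
Qed.

End Packing.

(** * Spin systems of finite range *)

Section Model.
Variables (R : realType) (V : choiceType) (adj : rel V) (D : nat).
Variables (iota : V -> 'rV[R]_D) (d : nat) (Phi : interaction R V d).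
Hypothesis hG : graph_assumption adj iota.
Hypothesis hI : interaction_assumption adj Phi.
Hypothesis hFF : frustration_free Phi.
Implicit Types (X Y L : {fset V}).

Lemma interaction_bounded : exists2 M : R, 0 < M & forall X v,
  rip _ _ (act (Phi X) v) (act (Phi X) v) <= M ^+ 2 * rip R _ v v.
Proof.
have [_ _ hmax _] := hI.
(* Adding [1] keeps [M] positive even if all terms vanish. *)
pose M : R := `|fine (Phi_max Phi)| + 1.
have M0 : 0 < M by rewrite ltr_wpDl.
have unit_le X (v : rvec R #|config d X|) : ipnorm (rip R _) v <= 1 ->
    ipnorm (rip R _) (act (Phi X) v) <= M.
  move=> v1; have : ((ipnorm (rip R _) (act (Phi X) v))%:E <= Phi_max Phi)%E.
    apply: (@le_trans _ _ (opnorm (Phi X))); last first.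
      by apply: ereal_sup_ubound; exists X.
    apply: ereal_sup_ubound; exists v; first by rewrite /= l2norm_rip.
    by rewrite -l2norm_rip.
  move: hmax; rewrite /M; case: (Phi_max Phi) => [r _||]//=.
  rewrite lee_fin => /le_trans; apply.
  by rewrite (le_trans (ler_norm _))// lerDl.
exists M => // X v; have [->|v0] := eqVneq v 0; first by rewrite linear0 !ip0r mulr0.
have n0 : 0 < ipnorm (rip R _) v.
  rewrite lt_neqAle ipnorm_ge0 andbT eq_sym; apply: contra_neq v0 => n0.
  by apply: rip_eq0; rewrite -ipnorm_sqr n0 expr0n.
have nZ (u : rvec R #|config d X|) c : 0 <= c ->
    ipnorm (rip R _) (c *: u) = c * ipnorm (rip R _) u.
  move=> c0; rewrite /ipnorm ipZl ipZr mulrA -expr2 sqrtrM ?sqr_ge0//.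
  by rewrite sqrtr_sqr ger0_norm.
have := unit_le X ((ipnorm (rip R _) v)^-1 *: v).
rewrite linearZ !nZ ?invr_ge0 ?(ltW n0)// mulVf ?gt_eqF// lexx => /(_ isT).
rewrite mulrC ler_pdivrMr// => h.
by rewrite -!ipnorm_sqr -exprMn ler_pXn2r ?nnegrE ?ipnorm_ge0// mulr_ge0 ?ltW.
Qed.

Lemma Phi_psd X : psd (Phi X).
Proof. by have [] := hI. Qed.

(** There is only one configuration of the empty set, so its Hamiltonian is a scalar, and
    frustration-freeness makes it zero. *)
Lemma Phi_fset0 : Phi fset0 = 0.
Proof.
have [v v0] := hFF fset0.
have -> : hamiltonian Phi fset0 = Phi fset0.
  have LL : (@fset0 V `<=` @fset0 V)%fset by [].
  rewrite -[RHS](extend_id LL) -(ext0E LL).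
  transitivity (\sum_(X <- fpowerset (@fset0 V)) ext0 fset0 (Phi X)).
    rewrite /hamiltonian big_seq_fsetE /=; apply: eq_bigr => X _.
    by rewrite -ext0E.
  by rewrite fpowerset0 big_seq_fset1.
move=> Pv; have one (a b : 'I_#|config d (fset0 : {fset V})|) : a = b.
  by apply: enum_val_inj; apply/ffunP => -[x xP]; have := xP; rewrite inE.
apply/matrixP => a b; rewrite mxE.
have [k vk] : exists k, v k ord0 != 0.
  apply/existsP; apply: contra_neqT v0 => /existsPn h.
  by apply/colP => k; rewrite [RHS]mxE; have := h k; rewrite negbK => /eqP.
have /matrixP/(_ a ord0) := Pv; rewrite !mxE (bigD1 k)//= big1 ?addr0; last first.
  by move=> j jk; rewrite (one j k) eqxx in jk.
by rewrite (one k b) in vk * => /eqP; rewrite mulf_eq0 (negbTE vk) orbF => /eqP.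
Qed.

Lemma support_diam : exists2 rho : R, 0 < rho & forall X, Phi X != 0 ->
  forall i j, i \in X -> j \in X -> eucl_norm (iota i - iota j) <= rho.
Proof.
have [_ _ [C C1 hC]] := hG; have [[r r0 hr] _ _ _] := hI.
have C0 : 0 < C := lt_le_trans ltr01 C1.
exists (C * r); first by rewrite mulr_gt0.
move=> X PX i j iX jX.
have dX : (diam R adj X <= r%:E)%E.
  by rewrite leNgt; apply: contra_neqN PX => /hr.
have dij : (graph_dist R adj i j <= r%:E)%E.
  by apply: le_trans dX; apply: ereal_sup_ubound; exists (i, j).
have [/le_trans/(_ dij) + _] := hC i j.
by rewrite lee_fin ler_pdivrMl.
Qed.

Lemma sites_separated : exists2 C : R, 1 <= C &
  forall i j, i != j -> 1 <= C * eucl_norm (iota i - iota j).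
Proof.
have [_ _ [C C1 hC]] := hG; exists C => // i j ij.
have [_ h] := hC i j; rewrite -lee_fin (le_trans _ h)//.
apply/ereal_infP => _ [p [_ pj] <-]; rewrite lee_fin ler1n lt0n size_eq0.
by apply: contra_neq ij => p0; rewrite -pj p0.
Qed.

(** All sites of a term touching [X] lie within [2 rho], coordinatewise, of a fixed site of [X].
    Packing leaves at most [P] such sites, hence at most [2 ^ P] such terms. *)
Lemma touch_bounded : exists2 g : nat, (0 < g)%N & forall L,
  {in terms Phi L, forall X, (count (touch X) (terms Phi L) <= g)%N}.
Proof.
have [D0 _ _] := hG; have [C C1 hC] := sites_separated.
have [rho rho0 hrho] := support_diam.
have rho2 : 0 <= 2 * rho by rewrite mulr_ge0 ?ltW.
have [P hP] := packing D0 C1 hC rho2.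
exists (2 ^ P)%N; first by rewrite expn_gt0.
move=> L X XL; have PX : Phi X != 0 by move: XL; rewrite mem_filter => /andP[].
have [i0 i0X] : exists i0, i0 \in X.
  by apply/fset0Pn; apply: contra_neq PX => ->; exact: Phi_fset0.
pose near_i0 j := [forall c, `|iota j ord0 c - iota i0 ord0 c| <= 2 * rho].
pose Z : {fset V} := [fset j in L | near_i0 j]%fset.
have ZP : (#|` Z| <= P)%N.
  apply: (hP i0); first exact: fset_uniq.
  by move=> j; rewrite !inE => /andP[_ /forallP].
apply: (@leq_trans #|` fpowerset Z|); last by rewrite card_fpowerset leq_exp2l.
rewrite -size_filter uniq_leq_size//.
  by rewrite !filter_uniq// fset_uniq.
move=> Y; rewrite mem_filter => /andP[XY YL].
have PY : Phi Y != 0 by move: YL; rewrite mem_filter => /andP[].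
have [k kX kY] : exists2 k, k \in X & k \in Y.
  case/orP : XY => [/eqP <-|/fdisjointP h]; first by exists i0.
  apply: contrapT => hn; apply: h => k kX; apply/negP => kY.
  by apply: hn; exists k.
rewrite fpowersetE; apply/fsubsetP => j jY.
rewrite !inE (fsubsetP (terms_sub YL))//=; apply/forallP => c.
have coord X' i i' : Phi X' != 0 -> i \in X' -> i' \in X' ->
    `|iota i ord0 c - iota i' ord0 c| <= rho.
  move=> PX' iX iX'; apply: le_trans (hrho X' PX' i i' iX iX').
  by have := coord_le_eucl_norm (iota i - iota i') c; rewrite !mxE.
have -> : iota j ord0 c - iota i0 ord0 c =
    (iota j ord0 c - iota k ord0 c) + (iota k ord0 c - iota i0 ord0 c) by ring.
rewrite (le_trans (ler_normD _ _))// mulr_natl mulr2n lerD//.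
  exact: coord PY jY kY.
exact: coord PX kX i0X.
Qed.

Lemma D_gt0 : (0 < D)%N.
Proof. by case: hG. Qed.

Lemma l_gt0 k : 0 < l_ R D k.
Proof. by apply: powR_gt0; rewrite divr_gt0. Qed.

Lemma l_mono i j : (i <= j)%N -> l_ R D i <= l_ R D j.
Proof.
move=> ij; rewrite ler_powR//; first by rewrite ler_pdivlMr// mul1r ler_nat.
by rewrite ler_wpM2r ?invr_ge0 ?ler0n// ler_nat.
Qed.

Lemma l_addD k : l_ R D (k + D) = 3 / 2 * l_ R D k.
Proof.
have D0 : D%:R != 0 :> R by rewrite pnatr_eq0 -lt0n D_gt0.
rewrite /l_ (natrD _ k D) (mulrDl k%:R) divff// powRD; last first.
  by apply/implyP => _; rewrite gt_eqF// divr_gt0.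
by rewrite powRr1 ?divr_ge0// mulrC.
Qed.

Lemma gapF_mono k : (gapF iota Phi k.+1 <= gapF iota Phi k)%E.
Proof.
apply: ereal_inf_le_tmp => _ [L [s [t h]] <-]; exists L => //.
exists s, t => i /h hi c; have /andP[-> /le_trans-> //] := hi c.
by apply: l_mono; rewrite addSn ltnW.
Qed.

End Model.

(** * From one family of boxes to the next *)

Section Step.
Variables (R : realType) (V : choiceType) (adj : rel V) (D : nat).
Variables (iota : V -> 'rV[R]_D) (d : nat) (Phi : interaction R V d).
Hypothesis hG : graph_assumption adj iota.
Hypothesis hI : interaction_assumption adj Phi.
Hypothesis hFF : frustration_free Phi.
Implicit Types (X Y L : {fset V}).

(* The coordinate of the longest side of the box is cut and moved to the front,
   where [box k] has side [l_ (k + 1)]. *)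
Lemma F_split k L : F_ iota k.+1 [set` L] -> exists f : V -> R,
  [/\ forall i j, f i <= f j + eucl_norm (iota i - iota j),
      forall c, c <= l_ R D k.+1 -> F_ iota k [set` below f L c] &
      forall c, l_ R D k.+1 / 2 <= c -> F_ iota k [set` above f L c]].
Proof.
have D0 := D_gt0 hG; move=> [s [t hst]].
pose z : 'I_D := Ordinal D0; pose last := ord_pred z.
have lastE : (last : nat) = D.-1.
  by rewrite /= add0n modn_small// prednK.
pose y i (c : 'I_D) : R := (col_perm s (iota i) + t) ord0 c.
have yE i c : y i c = iota i ord0 (s c) + t ord0 c by rewrite /y !mxE.
have box_out (A : {fset V}) (shift : R) : (forall i, i \in A -> i \in L) ->
    (forall i, i \in A -> 0 <= y i last - shift <= l_ R D k.+1) ->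
    F_ iota k [set` A].
  move=> AL hA; pose pi : 'S_D := perm (@ord_pred_inj D).
  (* The cyclic shift brings the last coordinate to the front; for [c > 0], side [c - 1] of
     [box k.+1] is as long as side [c] of [box k], so only the cut coordinate has to shrink. *)
  exists (pi * s)%g, (\row_c (t ord0 (pi c) - (if c == z then shift else 0))).
  move=> i iA c; rewrite !mxE permM addrA -yE permE.
  case: eqP => [->|/eqP cz].
    by rewrite addn1; apply: hA.
  have c0 : (0 < c)%N by rewrite lt0n; apply: contra cz => /eqP h; apply/eqP/val_inj.
  have pc : (ord_pred c).+1 = c :> nat.
    by rewrite /= -(prednK c0) addSn /= modnDr modn_small prednK// ltnW// prednK.
  rewrite subr0; have := hst i (AL i iA) (ord_pred c).
  by rewrite pc addSnnS.
exists (fun i => y i last); split.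
- move=> i j; rewrite !yE -lerBlDl.
  apply: le_trans (coord_le_eucl_norm _ (s last)); rewrite !mxE.
  by rewrite opprD addrACA subrr addr0 ler_norm.
- move=> c cl; apply: (box_out _ 0) => i; rewrite !inE => /andP[iL ic]//.
  rewrite subr0; have /andP[-> _] := hst i iL last.
  by rewrite (le_trans (ltW ic)).
(* The longest side is [3/2] of [l_ k.+1], so cutting off its first [l_ k.+1 / 2] leaves exactly
   [l_ k.+1]. *)
- move=> c cl; apply: (box_out _ (l_ R D k.+1 / 2)) => i; rewrite !inE => /andP[iL ic]//.
  rewrite subr_ge0 (le_trans cl ic) /=.
  have /andP[_] := hst i iL last.
  rewrite lastE prednK// (l_addD hG) -/(y i last) => h.
  by rewrite lerBlDr (le_trans h)//; lra.
Qed.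

Lemma gapF_step : exists rho eta : R, [/\ 0 < rho, 0 < eta &
  forall (k m s : nat) (mu : R), (0 < m)%N -> (0 < s)%N -> 0 <= mu ->
    16 * rho * s%:R * m%:R <= l_ R D k.+1 -> (mu%:E <= gapF iota Phi k)%E ->
    ((s%:R / s.+1%:R * mu - eta / (2 * m%:R ^+ 2))%:E <= gapF iota Phi k.+1)%E].
Proof.
have [M M0 hM] := interaction_bounded hI.
have [rho rho0 hrho] := support_diam hG hI.
have [g g0 hg] := touch_bounded hG hI hFF.
exists rho, (M * g%:R ^+ 2); split=> //.
  by rewrite mulr_gt0// exprn_gt0// ltr0n.
move=> k m s mu m0 s0 mu0 hl hmu; apply/ereal_infP => _ [L FL <-].
have [f [flip fbelow fabove]] := F_split FL.
set l := l_ R D k.+1 in hl fbelow fabove.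
have l0 : 0 < l := l_gt0 _ _ _.
have s1 : 0 < s%:R :> R by rewrite ltr0n.
(* The [s] overlaps fill the interval [[l / 2, l]] of admissible cuts; [8 rho m <= w] then becomes
   [16 rho s m <= l]. *)
pose w := l / (2 * s%:R).
have fd X : Phi X != 0 -> forall i j, i \in X -> j \in X -> f i <= f j + rho.
  by move=> PX i j iX jX; rewrite (le_trans (flip i j))// lerD2l (hrho X).
have mu_gap A : F_ iota k [set` A] -> (mu%:E <= gap (hamiltonian Phi A))%E.
  by move=> FA; apply: (le_trans hmu); apply: ereal_inf_lbound; exists A.
apply: (gap_step M0 (Phi_psd hI) hM (Phi_fset0 hFF) rho0 fd (a := l / 2) (w := w) g0 (hg L)) => //.

  by rewrite /w ler_pdivlMr ?mulr_gt0//; lra.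
move=> j js; have jw n : (n <= s)%N -> n%:R * w <= l / 2.
  move=> ns; have -> : l / 2 = s%:R * w by rewrite /w; field; rewrite gt_eqF.
  by rewrite ler_wpM2r ?ler_nat// /w divr_ge0 ?mulr_ge0 ?ltW.
split; apply: mu_gap.
  by apply: fbelow; have := jw j.+1 js; lra.
by apply: fabove; rewrite lerDl mulr_ge0// /w divr_ge0 ?mulr_ge0 ?ltW.
Qed.

End Step.

(** * Decay of the gaps *)

Section Decay.
Variables (R : realType) (G : nat -> \bar R) (q C : R) (k1 : nat).
Hypotheses (q_gt0 : 0 < q) (q_lt1 : q < 1) (C_gt0 : 0 < C).
Hypothesis G_mono : forall k, (G k.+1 <= G k)%E.
Hypothesis G_step : forall k (mu : R), (k1 <= k)%N -> 0 <= mu -> (mu%:E <= G k)%E ->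
  (((k * k.+2)%:R / (k * k.+2).+1%:R * mu - C * k.+1%:R ^+ 4 * q ^+ k)%:E <= G k.+1)%E.
Hypothesis G_inf : forall delta : R, 0 < delta -> exists k, (G k < delta%:E)%E.

Let K := 2 * C / (1 - q).

Let E k : R := K * k%:R ^+ 4 * q ^+ k.

Let K_gt0 : 0 < K.
Proof. by rewrite divr_gt0 ?mulr_gt0// subr_gt0. Qed.

(** With [n = k + 1], passing from [n^4] to [(n - 1)^4] loses at most [4 n^3], and [8 <= (1 - q) n]
    makes this at most half of [(1 - q) n^4]. The other half is the error, by the choice of [K]. *)
Let E_step k : 8 <= (1 - q) * k.+1%:R -> C * k.+1%:R ^+ 4 * q ^+ k <= E k - E k.+1.
Proof.
move=> hk; rewrite /E (exprS q k) [K * _ * (q * _)]mulrA -mulrBl ler_pM2r ?exprn_gt0//.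
have -> : C = K * (1 - q) / 2 by rewrite /K mulfVK ?gt_eqF ?subr_gt0//; field.
rewrite -(mulrA K) -!(mulrA K) -mulrBr ler_pM2l//.
have -> : k%:R = k.+1%:R - 1 :> R by rewrite -natr1 addrK.
have : 1 <= k.+1%:R :> R by rewrite ler1n.
move: k.+1%:R hk => n hk n1.
have : 0 <= n ^+ 3 * ((1 - q) * n - 8).
  by rewrite mulr_ge0 ?subr_ge0// exprn_ge0//; lra.
have : 0 <= 6 * n ^+ 2 - 4 * n + 1 by nra.
lra.
Qed.

Let f k : R := k.+1%:R / k%:R.

(* [f] solves the homogeneous recursion and [E] dominates the tail of the error
   series, so a large value of [G] at [k] propagates to all later indices. *)
Lemma no_decay k (mu : R) : (k1 <= k)%N -> (0 < k)%N -> 8 <= (1 - q) * k.+1%:R ->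
  4 * E k <= mu -> (mu%:E <= G k)%E -> forall j, ((E k)%:E <= G (k + j)%N)%E.
Proof.
move=> kk1 k0 hk hmu hG j.
have E0 i : 0 <= E i.
  apply: mulr_ge0; last by rewrite exprn_ge0// ltW.
  by apply: mulr_ge0; [exact: ltW | rewrite exprn_ge0].
have pos i : 0 < (k + i)%:R :> R by rewrite ltr0n addn_gt0 k0.
have f1 i : 1 <= f (k + i).
  by rewrite /f ler_pdivlMr// mul1r ler_nat.
have f2 : f k <= 2.
  rewrite /f ler_pdivrMr ?ltr0n// -natrM ler_nat mul2n -addnn.
  by rewrite -addn1 leq_add2l.
(* Variation of constants: the claim is [G (k + i) >= f (k + i) * nu i]. Since [f k <= 2] and
   [4 E k <= mu], [nu] starts at [2 E k] or more and loses at most [E k] in total. *)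
pose nu i := mu / f k - E k + E (k + i)%N.
have f0 : 0 < f k by have := f1 0; rewrite addn0; lra.
have nuE i : E k <= nu i.
  have : 2 * E k <= mu / f k.
    rewrite ler_pdivlMr// (le_trans _ hmu)//.
    by have := ler_wpM2l (E0 k) f2; lra.
  by rewrite /nu; have := E0 (k + i)%N; lra.
suff h : ((f (k + j) * nu j)%:E <= G (k + j)%N)%E.
  apply: le_trans h; rewrite lee_fin (le_trans (nuE j))// ler_peMl//.
  exact: le_trans (nuE j).
elim: j => [|j IH]; first by rewrite addn0 /nu addn0 subrK mulrC divfK// gt_eqF.
have nu0 : 0 <= nu j by exact: le_trans (nuE j).
have fn0 : 0 <= f (k + j) by exact: le_trans (f1 j).
have kj : (k1 <= k + j)%N by rewrite (leq_trans kk1)// leq_addr.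
have := G_step kj (mulr_ge0 fn0 nu0) IH.
rewrite addnS; apply: le_trans; rewrite lee_fin mulrA.
have -> : ((k + j) * (k + j).+2)%:R / ((k + j) * (k + j).+2).+1%:R * f (k + j) =
    f (k + j).+1.
  have -> : ((k + j) * (k + j).+2).+1 = ((k + j).+1 * (k + j).+1)%N.
    by rewrite mulnS mulSn addSn.
  rewrite /f !natrM; field.
  by rewrite -natrD nat1r !pnatr_eq0 /= -lt0n addn_gt0 k0.
have hE : 8 <= (1 - q) * (k + j).+1%:R.
  by rewrite (le_trans hk)// ler_wpM2l ?subr_ge0 ?(ltW q_lt1)// ler_nat ltnS leq_addr.
have e1 : nu j.+1 = nu j - (E (k + j)%N - E (k + j).+1) by rewrite /nu addnS; ring.
have := E_step hE; have := f1 j.+1; rewrite addnS e1 => g1 g2.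
set D := E _ - E _ in g2 *; set c := C * _ * _ in g2 *.
have : c <= f (k + j).+1 * D.
  by rewrite (le_trans g2)// ler_peMl// (le_trans _ g2)// !mulr_ge0 ?exprn_ge0 ?(ltW C_gt0) ?(ltW q_gt0).
lra.
Qed.

(** Otherwise some large [k] violates the bound; as [k^e >= 4 K / c], this gives [G k >= 4 E k], and
    [no_decay] with monotonicity keeps all of [G] above [E k > 0], against [G_inf]. *)
Lemma decay (e c : R) : 0 < e -> 0 < c ->
  \forall k \near \oo, (G k <= (c * (k%:R `^ (4 + e) * q ^+ k))%:E)%E.
Proof.
move=> e0 c0; near=> k.
have k0 : (0 < k)%N by near: k; exact: nbhs_infty_gt.
have kk1 : (k1 <= k)%N by near: k; exact: nbhs_infty_ge.
have hk : 8 <= (1 - q) * k.+1%:R.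
  rewrite mulrC -ler_pdivrMr ?subr_gt0// (@le_trans _ _ k%:R) ?ler_nat//.
  by near: k; exact: nbhs_infty_ger.
have hke : 4 * K / c <= k%:R `^ e.
  have h : (4 * K / c) `^ (e^-1) <= k%:R by near: k; exact: nbhs_infty_ger.
  have p0 : 0 <= 4 * K / c.
    by apply: divr_ge0; [apply: mulr_ge0 => //; exact: ltW | exact: ltW].
  have -> : 4 * K / c = ((4 * K / c) `^ e^-1) `^ e.
    by rewrite -powRrM mulVf ?gt_eqF// powRr1.
  by apply: ge0_ler_powR; rewrite ?nnegrE ?powR_ge0 ?ler0n// ltW.
rewrite leNgt; apply/negP => /ltW hG.
have kn0 : k%:R != 0 :> R by rewrite pnatr_eq0 -lt0n.
have hmu : 4 * E k <= c * (k%:R `^ (4 + e) * q ^+ k).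
  rewrite powRD ?kn0 ?implybT// powR_mulrn ?ler0n// /E.
  rewrite ler_pdivrMr// in hke.
  have : 0 <= k%:R ^+ 4 * q ^+ k by rewrite mulr_ge0 ?exprn_ge0 ?ler0n ?(ltW q_gt0).
  by move=> h; have := ler_wpM2l h hke; lra.
have Ek : 0 < E k.
  apply: mulr_gt0; last by rewrite exprn_gt0.
  by apply: mulr_gt0; rewrite ?exprn_gt0 ?ltr0n.
have [n] := G_inf Ek; apply/negP; rewrite -leNgt.
have h := no_decay kk1 k0 hk hmu hG.
have [ki|ik] := leqP k n; first by rewrite -(subnKC ki); exact: h.
rewrite (@le_trans _ _ (G k))//; first by have := h 0; rewrite addn0.
apply: (@homo_leq _ G (fun x y => (y <= x)%E)) (ltnW ik) => // [x y z xy yz].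
exact: le_trans yz xy.
Unshelve. all: by end_near. Qed.

End Decay.

(** * Growth of the side lengths *)

Section SideLengths.
Variables (R : realType) (D : nat).
Hypothesis D_gt0 : (0 < D)%N.

Definition ratio : R := (3 / 2) `^ D%:R^-1.

Lemma l_expr k : l_ R D k = ratio ^+ k.
Proof. by rewrite /l_ (mulrC k%:R) powRrM powR_mulrn ?powR_ge0. Qed.

Lemma ratio_gt1 : 1 < ratio.
Proof.
have e : ratio ^+ D = 3 / 2.
  by rewrite -l_expr /l_ divff ?powRr1 ?divr_ge0// pnatr_eq0 -lt0n.
rewrite ltNge; apply/negP => h.
have := exprn_ile1 D (powR_ge0 _ _) h; rewrite e; lra.
Qed.

Lemma bernoulli_ge (h : R) k : 0 <= h -> 1 + k%:R * h <= (1 + h) ^+ k.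
Proof.
move=> h0; elim: k => [|k IH]; first by rewrite mul0r addr0 expr0.
rewrite exprS -natr1 (le_trans _ (ler_wpM2l (addr_ge0 ler01 h0) IH))//.
by have : 0 <= k%:R :> R by []; nra.
Qed.

(** Bernoulli's inequality for the cube root [tau] of the ratio makes [tau ^ k] at least linear in
    [k], so its cube [l_ k] grows at least cubically. *)
Lemma l_ge_square (B : R) : 0 <= B ->
  \forall k \near \oo, B * k.+1%:R ^+ 2 <= l_ R D k.
Proof.
move=> B0; pose tau := ratio `^ 3%:R^-1.
have r0 : 0 < ratio := lt_trans ltr01 ratio_gt1.
have e : tau ^+ 3 = ratio.
  by rewrite -powR_mulrn ?powR_ge0// -powRrM mulVf ?powRr1 ?ltW// pnatr_eq0.
have tau1 : 1 < tau.
  rewrite ltNge; apply/negP => h.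
  have := exprn_ile1 3 (powR_ge0 _ _) h; rewrite e; have := ratio_gt1; lra.
pose h := tau - 1; have h0 : 0 < h by rewrite subr_gt0.
near=> k.
have k1 : 1 <= k%:R :> R by near: k; exact: nbhs_infty_ger.
have hk : 4 * B / h ^+ 3 <= k%:R by near: k; exact: nbhs_infty_ger.
rewrite ler_pdivrMr ?exprn_gt0// in hk.
have -> : l_ R D k = (tau ^+ k) ^+ 3 by rewrite l_expr -e -!exprM mulnC.
have : k%:R * h <= tau ^+ k.
  have := bernoulli_ge k (ltW h0); rewrite {2}/h (addrC 1 (tau - 1)) subrK; lra.
rewrite -natr1; move: (k%:R) (tau ^+ k) k1 hk => n t n1 hk ht.
have n0 : 0 <= n by lra.
have : (n * h) ^+ 3 <= t ^+ 3 by rewrite lerXn2r ?nnegrE// ?mulr_ge0 ?(ltW h0)//; nra.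
apply: le_trans.
have h2 : (n + 1) ^+ 2 <= 4 * n ^+ 2 by nra.
have := ler_wpM2l B0 h2; have := ler_wpM2l (sqr_ge0 n) hk; lra.
Unshelve. all: by end_near. Qed.

End SideLengths.

(** * Conclusion: the recursion along the boxes *)

Lemma gapF_ge0 (R : realType) (V : choiceType) (adj : rel V) (D : nat)
    (iota : V -> 'rV[R]_D) (d : nat) (Phi : interaction R V d) k :
  interaction_assumption adj Phi -> (0 <= gapF iota Phi k)%E.
Proof.
move=> hI; apply/ereal_infP => _ [L _ <-].
have [->//|[x [x0 -> _]]] := gap_attained (psd_ham (Phi_psd hI) L).
by rewrite lee_fin ltW.
Qed.

Local Close Scope sesquilinear_scope.
Local Close Scope complex_scope.

Theorem theorem1p4 (R : realType) (V : choiceType) (adj : rel V)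
  (adj_sym : symmetric adj)
  (D : nat) (iota : V -> 'rV[R]_D) (hG : graph_assumption adj iota)
  (d : nat) (d_gt0 : (0 < d)%N) (Phi : interaction R V d)
  (hI : interaction_assumption adj Phi) (hFF : frustration_free Phi)
  (hgap : gapGamma iota Phi = 0%E) :
  forall e : R, 0 < e ->
    (\forall k \near \oo, gapF iota Phi k \is a fin_num) /\
    (fun k : nat => fine (gapF iota Phi k)) =o_\oo
      (fun k : nat => k%:R `^ (4 + e) / l_ R D k ^+ 2).
Proof.
move=> e e0; have D0 := D_gt0 hG.
have [rho [eta [rho0 eta0 step]]] := gapF_step hG hI hFF.
pose r := ratio R D; have r1 : 1 < r := ratio_gt1 R D0.
have r0 : 0 < r := lt_trans ltr01 r1.
pose q := r ^- 2.
have q0 : 0 < q by rewrite invr_gt0 exprn_gt0.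
have q1 : q < 1 by rewrite invf_lt1 ?exprn_gt0// exprn_egt1.
have lq k : (l_ R D k ^+ 2)^-1 = q ^+ k by rewrite l_expr exprVn -!exprM mulnC.
(* Here [512 = 32^2 / 2]: the choice of [m] below gives [l_ k <= 32 m rho (k + 1)^2], hence
   [eta / (2 m^2) <= C (k + 1)^4 / l_k^2]. *)
pose C := 512 * eta * rho ^+ 2.
have C0 : 0 < C.
  by apply: mulr_gt0; [apply: mulr_gt0; first rewrite ltr0n | exact: exprn_gt0].
have [k1 _ hk1] : \forall k \near \oo, 16 * rho * k.+1%:R ^+ 2 <= l_ R D k.
  by apply: l_ge_square => //; rewrite mulr_ge0 ?ltW.
(* Starting at [k1.+1] ensures [k > 0], so that the number [k (k + 2)] of cuts is positive. *)
have qstep k (mu : R) : (k1.+1 <= k)%N -> 0 <= mu -> (mu%:E <= gapF iota Phi k)%E ->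
    (((k * k.+2)%:R / (k * k.+2).+1%:R * mu - C * k.+1%:R ^+ 4 * q ^+ k)%:E
      <= gapF iota Phi k.+1)%E.
  move=> kk mu0 hmu; pose s := (k * k.+2)%N.
  have s0 : (0 < s)%N by rewrite muln_gt0 (leq_trans _ kk).
  have sR : 0 < s%:R :> R by rewrite ltr0n.
  have s_le : s%:R <= k.+1%:R ^+ 2 :> R.
    by rewrite -natrX ler_nat /s expnS expn1 mulnS mulSn leq_add2r.
  pose L := l_ R D k.+1; have L0 : 0 < L := l_gt0 _ _ _.
  pose B := 16 * rho * s%:R; have B0 : 0 < B by rewrite !mulr_gt0.
  have BL : B <= L.
    rewrite (le_trans _ (l_mono R D (leqnSn k)))// (le_trans _ (hk1 k (ltnW kk)))//.
    by rewrite ler_wpM2l// mulr_ge0 ?ltW.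
  (* The largest [m] that the step allows; as [L / B >= 1], rounding down costs at most a factor
     [2]. *)
  pose m := Num.truncn (L / B).
  have LB1 : 1 <= L / B by rewrite ler_pdivlMr// mul1r.
  have m0 : (0 < m)%N by rewrite truncn_gt0.
  have mR : 1 <= m%:R :> R by rewrite ler1n.
  have mle : m%:R <= L / B by rewrite truncn_le (le_trans ler01).
  have mge : L / B <= 2 * m%:R.
    by have := truncnS_gt (L / B); rewrite -/m -natr1; lra.
  have := step k m s mu m0 s0 mu0 _ hmu.
  rewrite -/L -/B mulrC -ler_pdivlMr// => /(_ mle).
  apply: le_trans; rewrite lee_fin lerD2l lerN2.
  rewrite -lq; pose n : R := k.+1%:R; pose T : R := 32 * m%:R * rho * n ^+ 2.
  have lk0 : 0 < l_ R D k := l_gt0 _ _ _.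
  have lT : l_ R D k <= T.
    rewrite (le_trans (l_mono R D (leqnSn k)))// -/L.
    rewrite ler_pdivrMr// in mge; rewrite (le_trans mge)//.
    have -> : T = 2 * m%:R * (16 * rho * n ^+ 2) by rewrite /T; ring.
    by rewrite ler_wpM2l ?mulr_ge0// ler_wpM2l// mulr_ge0 ?ltW.
  have m2 : 0 < 2 * m%:R ^+ 2 :> R.
    by apply: mulr_gt0 => //; rewrite exprn_gt0// ltr0n.
  rewrite ler_pdivrMr// -/n.
  have -> : C * n ^+ 4 / l_ R D k ^+ 2 * (2 * m%:R ^+ 2) =
      eta * (T ^+ 2 / l_ R D k ^+ 2) by rewrite /C /T; ring.
  rewrite ler_peMr ?(ltW eta0)// ler_pdivlMr ?exprn_gt0// mul1r.
  by rewrite lerXn2r ?nnegrE ?(ltW lk0)// (le_trans (ltW lk0)).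
have inf (delta : R) : 0 < delta -> exists k, (gapF iota Phi k < delta%:E)%E.
  move=> d0; have : (gapGamma iota Phi < delta%:E)%E by rewrite hgap lte_fin.
  by move=> /ereal_inf_lt[_ [n _ <-] hn]; exists n.
have dec c : 0 < c -> \forall k \near \oo,
    (gapF iota Phi k <= (c * (k%:R `^ (4 + e) / l_ R D k ^+ 2))%:E)%E.
  move=> c0; have := decay q0 q1 C0 (gapF_mono iota Phi) qstep inf e0 c0.
  by apply: filterS => k; rewrite lq.
(* [fine] maps infinite values to [0], so finiteness is established before passing to real
   numbers. *)
have fin k (x : R) : (gapF iota Phi k <= x%:E)%E -> gapF iota Phi k \is a fin_num.
  move=> hx; rewrite ge0_fin_numE ?(gapF_ge0 _ _ hI)//.
  exact: le_lt_trans hx (ltry _).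
split; first by have := dec 1 ltr01; apply: filterS => k; exact: fin.
apply/eqoP => c c0; have := dec c c0; apply: filterS => k hk.
have g0 := gapF_ge0 iota k hI.
rewrite ger0_norm ?fine_ge0// ger0_norm; last first.
  by rewrite divr_ge0 ?powR_ge0 ?exprn_ge0 ?powR_ge0.
by rewrite -lee_fin fineK// (fin _ _ hk).
Qed.
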